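(* Let $\beta\in(\tfrac43,2)$. For each fixed $x\in\mathbb{T}$, almost surely the function $t\mapsto Y(t,x)$ is (up to modification) Hölder continuous on $[0,T]$ of order $\delta$ for every $0<\delta<\frac{1}{\beta}$. Hence, for each fixed $x\in\mathbb{T}$, almost surely the function $t\mapsto u(t,x)=X(t,x)+Y(t,x)$ is (up to modification) Hölder continuous of order $\delta$ for every $0<\delta<\frac14$.
   Context: Fix $T>0$. $\mathbb{T}=\mathbb{R}/\mathbb{Z}$ is the one-dimensional flat torus, identified with $[0,1)$ with periodic boundary conditions. $p_t(x)=\sum_{k\in\mathbb{Z}}\frac{1}{\sqrt{4\pi t}}e^{-(x-k)^2/(4t)}$ is the periodic heat kernel. $W$ is a space-time Gaussian white noise on $[0,T]\times\mathbb{T}$, i.e. a centered Gaussian family with $\mathbf{E}[W(A)W(B)]=\lambda(A\cap B)$ for Borel $A,B\subset[0,T]\times\mathbb{T}$, $\lambda$ being Lebesgue measure. Let $f(u)=u-u^3$, and let $u$ be the unique mild solution, with zero initial condition, of the stochastic Allen--Cahn equation $\partial_t u=\partial_x^2u+f(u)+\dot W$ on $[0,T]\times\mathbb{T}$, i.e. $u=X+Y$ with $$X(t,x)=\int_0^t\!\int_{\mathbb{T}}p_{t-s}(x-y)\,W(ds,dy),\qquad Y(t,x)=\int_0^t\!\int_{\mathbb{T}}p_{t-s}(x-y)f(u(s,y))\,dy\,ds;$$ it satisfies $\sup_{t\in[0,T],x\in\mathbb{T}}\mathbf{E}|u(t,x)|^q<\infty$ for all $q\ge2$. *)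

(* Defs.v *)
From mathcomp Require Import all_boot all_order all_algebra.
From mathcomp Require Import all_classical all_reals all_analysis.

Set Implicit Arguments.
Unset Strict Implicit.
Unset Printing Implicit Defensive.

Import Order.TTheory GRing.Theory Num.Theory.
Import numFieldNormedType.Exports HBSimple.

Local Open Scope classical_set_scope.
Local Open Scope ring_scope.

(* The torus R/Z is identified with [0, 1[; spatial differences [x - y] are
   taken in R, which is harmless because the kernel below is 1-periodic. *)
Definition torus (R : realType) : set R := `[0, 1[.

Definition cylinder (R : realType) (t : R) : set (R * R) :=
  `[0, t] `*` @torus R.

Notation leb2 R := (@lebesgue_measure R \x @lebesgue_measure R)%E.

(* Only relevant for [t > 0]; at [t <= 0] the value is 0 since [Num.sqrt] and
   then [_^-1] return 0. *)
Definition heat_kernel (R : realType) (t x : R) : R :=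
  fine (\esum_(k in [set: int])
    ((Num.sqrt (4 * pi * t))^-1 *
       expR (- ((x - k%:~R) ^+ 2 / (4 * t))))%:E).

Definition reaction (R : realType) (v : R) : R := v - v ^+ 3.

Section Probability.
Context (R : realType) (d : measure_display) (Omega : measurableType d)
        (P : probability Omega R).

(* [normal_prob m 0] is not the Dirac mass at [m] in the library, hence the
   separate degenerate case. *)
Definition centered_gaussian (X : Omega -> R) : Prop :=
  exists2 s : R, 0 <= s &
    forall A : set R, measurable A ->
      P (X @^-1` A) = if s == 0 then \d_(0 : R) A else normal_prob 0 s A.

(* [W A] is only meaningful for Borel sets [A] included in [0, T] x torus. *)
Definition white_noise (T : R) (W : set (R * R) -> {RV P >-> R}) : Prop :=
  (forall (n : nat) (A : 'I_n -> set (R * R)) (a : 'I_n -> R),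
     (forall i, measurable (A i) /\ A i `<=` cylinder T) ->
     centered_gaussian (fun w => \sum_(i < n) a i * W (A i) w)) /\
  (forall A B : set (R * R),
     measurable A -> A `<=` cylinder T ->
     measurable B -> B `<=` cylinder T ->
     'E_P[(fun w => (W A w * W B w)%R)] = leb2 R (A `&` B))%E.

Definition wiener_sintegral (W : set (R * R) -> {RV P >-> R})
    (D : set (R * R)) (h : {sfun (R * R)%type >-> R}) (w : Omega) : R :=
  \sum_(c \in range h) c * W (D `&` h @^-1` [set c]) w.

(* [I] is (a version of) the integral of [g] over [D] with respect to [W]:
   the L^2(P)-limit of the integrals of simple functions converging to [g]
   in L^2(D). *)
Definition is_wiener_integral (W : set (R * R) -> {RV P >-> R})
    (D : set (R * R)) (g : R * R -> R) (I : {RV P >-> R}) : Prop :=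
  exists h : nat -> {sfun (R * R)%type >-> R},
    ((fun n => \int[leb2 R]_(z in D) ((h n z - g z) ^+ 2)%R%:E)%E
        @ \oo --> 0%E) /\
    ((fun n => 'E_P[(fun w => ((wiener_sintegral W D (h n) w - I w) ^+ 2)%R)])%E
        @ \oo --> 0%E).

Definition is_stochastic_convolution (T : R) (W : set (R * R) -> {RV P >-> R})
    (X : R -> R -> {RV P >-> R}) : Prop :=
  forall t x : R, t \in `[0, T] -> torus x ->
    is_wiener_integral W (cylinder t)
      (fun z => heat_kernel (t - z.1) (x - z.2)) (X t x).

Definition drift_integrand (u : R -> R -> Omega -> R) (t x : R) (w : Omega)
    (z : R * R) : R :=
  heat_kernel (t - z.1) (x - z.2) * reaction (u z.1 z.2 w).

Definition drift (u : R -> R -> Omega -> R) (t x : R) (w : Omega) : R :=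
  \int[leb2 R]_(z in cylinder t) drift_integrand u t x w z.

Definition mild_solution (T : R) (X : R -> R -> {RV P >-> R})
    (u : R -> R -> Omega -> R) : Prop :=
  measurable_fun (cylinder T `*` [set: Omega])
    (fun z : (R * R) * Omega => u z.1.1 z.1.2 z.2) /\
  forall t x : R, t \in `[0, T] -> torus x ->
    {ae P, forall w,
      (leb2 R).-integrable (cylinder t) (EFin \o drift_integrand u t x w) /\
      u t x w = X t x w + drift u t x w}.

Definition bounded_moments (T : R) (u : R -> R -> Omega -> R) : Prop :=
  forall q : R, 2 <= q ->
    (ereal_sup [set 'E_P[(fun w => (`|u z.1 z.2 w| `^ q)%R)] | z in cylinder T]
       < +oo)%E.

Definition hoelder_on (D : set R) (delta : R) (g : R -> R) : Prop :=
  exists C : R, forall s t : R, D s -> D t ->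
    `|g t - g s| <= C * `|t - s| `^ delta.

(* A single modification serves all the exponents below [gamma]. *)
Definition has_hoelder_modification (T gamma : R) (Z : R -> Omega -> R)
    : Prop :=
  exists Zt : R -> {RV P >-> R},
    (forall t : R, t \in `[0, T] -> {ae P, forall w, Zt t w = Z t w}) /\
    {ae P, forall w, forall delta : R, 0 < delta < gamma ->
       hoelder_on `[0, T] delta (fun t => Zt t w)}.

End Probability.

(* Main.v *)
From HB Require Import structures.
Require Import Defs.
From mathcomp Require Import all_boot all_order all_algebra.
From mathcomp Require Import ring lra zify.
From mathcomp Require Import all_classical all_reals all_analysis.
From mathcomp Require Import measurable_realfun.

(** Both halves rest on how the kernel (r, y) |-> p_{t-r}(x-y), extended by 0 to
    r >= t, moves with t.

    For 0 < b <= a the Gaussian comparison p_a >= sqrt(b/a) p_b, together with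
    the fact that p_a and p_b both have mass 1 on the torus, shows that
    |p_a - p_b| has integral at most 2(a-b)/a. With p_a <= C/sqrt(a) this bounds
    the integral of (p_a - p_b)^2 by C(a-b)/(a sqrt(b)). As (a-b)/a lies in
    [0, 1], it is at most ((a-b)/a)^th for th in (0, 1], which leaves a
    singularity in time that is integrable; integrating over time, the L1
    distance of the kernels at times s and t is at most C|t-s|^th for every
    th < 1 (hker_L1_increment), and the square of their L2 distance is at most
    C|t-s|^th for every th < 1/2 (hker_L2_increment).

    Drift. The moment bound on u and Tonelli's theorem make the force f(u)
    belong to L14 of the space-time cylinder for almost every outcome. For such
    an outcome the drift itself is Hoelder of order 3/4: if k is
    the difference of two kernels and A > 0, then
    |k f| <= A|k| + A^-6 (k^2 + f^14), so that a drift increment is at most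
    C(A |t-s|^(7/8) + A^-6), and A = |t-s|^(-1/8) balances the two terms
    (drift_increment). This covers all orders below 1/beta, since 1/beta < 3/4.

    Stochastic convolution. X(t,x) - X(s,x) is an L2 limit of finite Gaussian
    combinations of the white noise, whose variances are controlled by the
    squared L2 distance of the kernels, that is by C|t-s|^th with th < 1/2.
    Gaussian tails then give, for every m,
    P(|X(t,x) - X(s,x)| >= l) <= C_m |t-s|^(th m) l^(-2m)
    (wiener_increment_tail, convolution_increment_tail). In Kolmogorov's
    criterion (kolmogorov_continuity) this yields all orders below
    (th m - 1)/(2m), and these exponents approach 1/4 as th tends to 1/2 and m
    to infinity. The solution u = X + Y inherits the smaller of the two
    regularities. *)

Set Implicit Arguments.
Unset Strict Implicit.
Unset Printing Implicit Defensive.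

Import Order.TTheory GRing.Theory Num.Theory.
Import numFieldNormedType.Exports HBSimple.

Local Open Scope classical_set_scope.
Local Open Scope ring_scope.

Lemma measurable_EFinTS (R : realType) d (X : measurableType d) (D : set X)
    (f : X -> R) :
  measurable_fun setT f -> measurable_fun D (fun z => (f z)%:E).
Proof. by move=> mf; apply/measurable_EFinP; exact: measurable_funTS. Qed.

Lemma measurable_abs_ge (R : realType) d (X : measurableType d) (f : X -> R)
    (lam : R) :
  measurable_fun setT f -> measurable [set w | lam <= `|f w|].
Proof.
move=> mf; have ma : measurable_fun setT (fun w => `|f w|) by exact: measurableT_comp.
have := ma measurableT `[lam, +oo[%classic (measurable_itv _); rewrite setTI.
by congr measurable; apply/seteqP; split => w /=; rewrite in_itv/= andbT.
Qed.

(** * The periodic heat kernel *)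

Lemma esum_int (R : realType) (F : int -> \bar R) : (forall k, 0 <= F k)%E ->
  (\esum_(k in [set: int]) F k = \sum_(0 <= n <oo) (F (Posz n) + F (Negz n)))%E.
Proof.
move=> F0; rewrite (esumID (range Posz))//.
have -> : [set: int] `&` range Posz = range Posz by rewrite setTI.
have -> : [set: int] `&` ~` range Posz = range Negz.
  rewrite setTI; apply/seteqP; split => -[n|n]//=.
  - by move=> /(_ (ex_intro2 _ _ n I erefl)).
  - by move=> _; exists n.
  - by move=> [? _ ?].
  - by move=> _ [? _ ?].
rewrite !esum_image; [|by move=> ? ? _ _ []..].
by rewrite -!nneseries_esumT// nneseriesD.
Qed.

Section gauss.
Variable R : realType.
Implicit Types t x y T : R.
Notation mu := (@lebesgue_measure R).

Definition gauss t x : R :=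
  (Num.sqrt (4 * pi * t))^-1 * expR (- (x ^+ 2 / (4 * t))).

Lemma gauss_ge0 t x : 0 <= gauss t x.
Proof. by rewrite mulr_ge0 ?expR_ge0 ?invr_ge0 ?sqrtr_ge0. Qed.

Lemma gauss_normal t x y : 0 < t ->
  gauss t (x - y) = normal_pdf x (Num.sqrt (2 * t)) y.
Proof.
move=> t0; rewrite normal_pdfE; last by rewrite gt_eqF// sqrtr_gt0 mulr_gt0.
rewrite /gauss /normal_peak /normal_fun sqr_sqrtr ?mulr_ge0 ?ltW//.
congr (_ * expR _).
  by congr ((Num.sqrt _)^-1); rewrite -mulr_natr; ring.
by field; rewrite gt_eqF.
Qed.

Lemma continuous_gauss t : continuous (gauss t).
Proof.
move=> x; apply: cvgM; first exact: cvg_cst.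
apply: continuous_comp; last exact: continuous_expR.
apply: cvgN; apply: cvgM; last exact: cvg_cst.
exact: exprn_continuous.
Qed.

Lemma measurable_gauss2 : measurable_fun setT (fun z : R * R => gauss z.1 z.2).
Proof.
(* For positive times the kernel is written with real powers, for which
   measurability in the base is available at all arguments. *)
pose f (z : R * R) := (4 * pi * z.1) `^ (- 2^-1) *
   expR (- (z.2 ^+ 2 * (4 * z.1) `^ (- 1))).
pose D := [set z : R * R | 0 < z.1].
have mD : measurable D.
  rewrite (_ : D = `]0, +oo[ `*` setT); first exact: measurableX.
  by apply/seteqP; split => -[t x] /=; rewrite /D/= in_itv/= andbT // => -[].
have mf : measurable_fun setT f.
  apply: measurable_funM.
    apply: (measurableT_comp (measurable_powR _)).
    by apply: measurable_funM => //; exact: measurable_fst.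
  apply: (measurableT_comp (@measurable_expR R)).
  apply: measurable_funN; apply: measurable_funM.
    by apply: measurable_funX; exact: measurable_snd.
  apply: (measurableT_comp (measurable_powR _)).
  by apply: measurable_funM => //; exact: measurable_fst.
rewrite (_ : (fun z => _) = \1_D \* f); last first.
  apply/funext => -[t x] /=; rewrite indicE /f/=; have [t0|t0] := ltP 0 t.
    rewrite mem_set// mul1r /gauss powRN powR12_sqrt ?powR_inv1 ?mulr_ge0 ?ltW//.
    by rewrite pi_gt0.
  rewrite memNset ?mul0r; last by rewrite /D/= ltNge t0.
  by rewrite /gauss ler0_sqrtr ?invr0 ?mul0r// pmulr_rle0// mulr_gt0 ?pi_gt0.
by apply: measurable_funM => //; exact: measurable_indic.
Qed.

Lemma integral_gauss t x : 0 < t -> (\int[mu]_y (gauss t (x - y))%:E = 1)%E.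
Proof.
move=> t0; under eq_integral do rewrite gauss_normal//.
exact: integral_normal_pdf.
Qed.

Lemma ge0_integral_itvco_split (f : R -> \bar R) (a b c : R) :
  a <= b -> b <= c -> measurable_fun setT f -> (forall x, 0 <= f x)%E ->
  (\int[mu]_(y in `[a, c[) f y =
   \int[mu]_(y in `[a, b[) f y + \int[mu]_(y in `[b, c[) f y)%E.
Proof.
move=> ab bc mf f0; rewrite -ge0_integral_setU//.
- by rewrite -itv_bndbnd_setU// bnd_simp.
- exact: measurable_funTS.
- apply/disj_setPS => y [/=]; rewrite !in_itv/= => /andP[_ yb] /andP[].
  by rewrite leNgt yb.
Qed.

(** A unit interval is translated by substitution; this is what unrolls the
    periodised kernel on [0, 1) into one Gaussian on the line. *)
Lemma integral_shift01 (f : R -> R) (a : R) : continuous f ->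
  (\int[mu]_(y in `[0%R, 1%R[) (f (y + a))%:E = \int[mu]_(y in `[a, (a + 1)%R[) (f y)%:E)%E.
Proof.
move=> cf.
have mf : measurable_fun setT f by exact: continuous_measurable_fun.
rewrite integral_itv_bndo_bndc; last first.
  apply/measurable_EFinP; apply: (@measurable_comp _ _ _ _ _ _ setT) => //.
  by apply: measurable_funD.
rewrite integral_itv_bndo_bndc; last first.
  by apply/measurable_EFinP; apply: measurable_funTS.
have F'E : (fun y => y + a)^`()%classic = cst (1 : R).
  apply/funext => y; rewrite derive1E deriveD// derive_id derive_cst.
  by rewrite addr0.
have := @integration_by_substitution_increasing R (fun y => y + a) f 0 1.
rewrite add0r addrC => ->//.
- by apply: eq_integral => y _ /=; rewrite F'E fctE/= mulr1.
- by move=> x y _ _ xy; rewrite ltrD2r.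
- by rewrite F'E => x _; exact: cvg_cst.
- by rewrite F'E; exact: is_cvg_cst.
- by rewrite F'E; exact: is_cvg_cst.
- split => [x _||]; first by [].
    by apply: cvg_at_right_filter; apply: cvgD => //; exact: cvg_cst.
  by apply: cvg_at_left_filter; apply: cvgD => //; exact: cvg_cst.
- exact: continuous_subspaceT.
Qed.

(** The images k = n and k = -(n+1) are grouped, so that the sum over the
    integers becomes a series over the naturals. *)
Definition gauss_pair t x (n : nat) : R := gauss t (x - n%:R) + gauss t (x + n.+1%:R).

Lemma gauss_pair_ge0 t x n : 0 <= gauss_pair t x n.
Proof. by rewrite addr_ge0 ?gauss_ge0. Qed.

Definition heat_series t x : \bar R := (\sum_(0 <= n <oo) (gauss_pair t x n)%:E)%E.

Lemma heat_series_ge0 t x : (0 <= heat_series t x)%E.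
Proof. by apply: nneseries_ge0 => n _ _; rewrite lee_fin gauss_pair_ge0. Qed.

Lemma heat_kernelE t x : heat_kernel t x = fine (heat_series t x).
Proof.
rewrite /heat_kernel esum_int; last by move=> k; rewrite lee_fin gauss_ge0.
congr fine; apply: eq_eseriesr => n _; rewrite /gauss_pair EFinD; congr (_ + _%:E)%E.
by rewrite /gauss NegzE mulrNz opprK.
Qed.

Lemma measurable_gauss_pair n :
  measurable_fun setT (fun z : R * R => gauss_pair z.1 z.2 n).
Proof.
apply: measurable_funD.
  apply: (measurableT_comp (f := fun z : R * R => gauss z.1 z.2) measurable_gauss2
    (g := fun z : R * R => (z.1, z.2 - n%:R))).
  apply/measurable_fun_pairP; split; first exact: measurable_fst.
  by apply: measurable_funB; [exact: measurable_snd|exact: measurable_cst].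
apply: (measurableT_comp (f := fun z : R * R => gauss z.1 z.2) measurable_gauss2
    (g := fun z : R * R => (z.1, z.2 + n.+1%:R))).
apply/measurable_fun_pairP; split; first exact: measurable_fst.
by apply: measurable_funD; [exact: measurable_snd|exact: measurable_cst].
Qed.

Lemma measurable_heat_series : measurable_fun setT (fun z : R * R => heat_series z.1 z.2).
Proof.
apply: ge0_emeasurable_sum => n *; first by rewrite lee_fin gauss_pair_ge0.
by apply/measurable_EFinP; exact: measurable_gauss_pair.
Qed.

Lemma measurable_heat : measurable_fun setT (fun z : R * R => heat_kernel z.1 z.2).
Proof.
under eq_fun do rewrite heat_kernelE.
apply: (measurableT_comp (f := fine)); first exact: fine_measurable.
exact: measurable_heat_series.
Qed.

(** The first N pairs of images of [0, 1) tile [-N, N) exactly; letting N grow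
    shows that the periodic kernel has mass 1. *)
Lemma integral_gauss_pair t x N : 0 < t ->
  (\sum_(0 <= n < N) \int[mu]_(y in `[0%R, 1%R[) (gauss_pair t (x - y) n)%:E =
   \int[mu]_(y in `[(- N%:R)%R, N%:R%R[) (gauss t (x - y))%:E)%E.
Proof.
move=> t0; have cg : continuous (fun y => gauss t (x - y)).
  move=> y; apply: (@continuous_comp _ _ _ (fun y => x - y)).
    by apply: cvgB => //; exact: cvg_cst.
  exact: continuous_gauss.
have mg D : measurable_fun D (fun y => (gauss t (x - y))%:E).
  apply/measurable_EFinP; apply: measurable_funTS.
  exact: continuous_measurable_fun.
have cg' a : continuous (fun y => gauss t (x - (y + a))).
  move=> y; apply: (@continuous_comp _ _ _ (fun y => x - (y + a))).
    by apply: cvgB; [exact: cvg_cst|apply: cvgD => //; exact: cvg_cst].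
  exact: continuous_gauss.
have mg' a D : measurable_fun D (fun y => (gauss t (x - (y + a)))%:E).
  by apply/measurable_EFinP; apply: measurable_funTS; exact: continuous_measurable_fun.
elim: N => [|N IH]; first by rewrite big_geq// oppr0 set_itvco0 integral_set0.
rewrite big_nat_recr//= IH.
have -> : (\int[mu]_(y in `[0%R, 1%R[) (gauss_pair t (x - y) N)%:E =
   \int[mu]_(y in `[N%:R, N.+1%:R[) (gauss t (x - y))%:E +
   \int[mu]_(y in `[(- N.+1%:R)%R, (- N%:R)%R[) (gauss t (x - y))%:E)%E.
  transitivity (\int[mu]_(y in `[0%R, 1%R[) ((gauss t (x - (y + N%:R)))%:E +
     (gauss t (x - (y - N.+1%:R)))%:E))%E.
    by apply: eq_integral => y _; rewrite -EFinD /gauss_pair !opprD !addrA opprK.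
  rewrite ge0_integralD; [|exact: measurable_itv
    |by move=> y _; rewrite lee_fin gauss_ge0|exact: mg'
    |by move=> y _; rewrite lee_fin gauss_ge0|exact: mg'].
  rewrite (integral_shift01 N%:R cg) (integral_shift01 (- N.+1%:R) cg).
  by rewrite -natr1 opprD addrNK.
have g0 y : (0 <= (gauss t (x - y))%:E)%E by rewrite lee_fin gauss_ge0.
rewrite (@ge0_integral_itvco_split _ (- N.+1%:R) (- N%:R) N.+1%:R)//; last 2 first.
- by rewrite lerN2 ler_nat.
- by rewrite (@le_trans _ _ 0) ?oppr_le0.
rewrite (@ge0_integral_itvco_split _ (- N%:R) N%:R N.+1%:R)//; last 2 first.
- by rewrite (@le_trans _ _ 0) ?oppr_le0.
- by rewrite ler_nat.
by rewrite [LHS]addeA [LHS]addeC.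
Qed.

Lemma integral_heat_series t x : 0 < t ->
  (\int[mu]_(y in `[0%R, 1%R[) heat_series t (x - y) = 1)%E.
Proof.
move=> t0; rewrite integral_nneseries//; last 2 first.
- move=> n; apply: measurable_funTS; apply/measurable_EFinP.
  apply: (measurableT_comp (f := fun z : R * R => gauss_pair z.1 z.2 n)
    (measurable_gauss_pair n) (g := fun y : R => (t, x - y))).
  apply: measurable_fun_pair; first exact: measurable_cst.
  by apply: (@measurable_funB _ _ _ _ (cst x) id).
- by move=> n y _; rewrite lee_fin gauss_pair_ge0.
rewrite -[RHS](integral_gauss x t0).
under eq_fun do rewrite integral_gauss_pair//.
have mg : measurable_fun setT (fun y => (gauss t (x - y))%:E).
  apply/measurable_EFinP; apply: (measurableT_comp (f := gauss t)).
    by apply: continuous_measurable_fun; exact: continuous_gauss.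
  by apply: measurable_funB => //.
have -> : [set: R] = \bigcup_N [set` `[- N%:R, N%:R[] :> set R.
  apply/esym; rewrite -subTset => y _; exists (Num.truncn `|y|).+1 => //=.
  rewrite in_itv/=; have := real_truncnS_gt (normr_real y).
  by rewrite ltr_norml => /andP[/ltW -> ->].
apply/cvg_lim => //; apply: ge0_nondecreasing_set_cvg_integral => //.
- apply/nondecreasing_seqP => n; apply/subsetPset => y /=; rewrite !in_itv/=.
  move=> /andP[ny yn]; rewrite (lt_le_trans yn) ?ler_nat// andbT.
  by rewrite (le_trans _ ny)// lerN2 ler_nat.
- by move=> n; exact: measurable_funTS.
- by move=> n y _; rewrite lee_fin gauss_ge0.
Qed.

(** A constant with p_t <= heat_bound T / sqrt t for 0 < t <= T; its form comes
    from [gauss_le]. *)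
Definition heat_bound T := expR (4 * T)^-1 * Num.sqrt (2 * T).

(** A Gaussian at time t <= T is dominated, up to the factor 1/sqrt t, by a
    wider Gaussian recentred at any v in [0, 1], because
    (x - v)^2 <= 2 x^2 + 2 v^2. The freedom in v is what allows averaging over a
    whole period. *)
Lemma gauss_le T t x v : 0 < t -> t <= T -> 0 <= v -> v <= 1 ->
  gauss t x <= (Num.sqrt t)^-1 * heat_bound T * gauss (2 * T) (x - v).
Proof.
rewrite /heat_bound.
move=> t0 tT v0 v1; have T0 := lt_le_trans t0 tT.
have pi0 := @pi_gt0 R; have pi4 : 0 <= 4 * pi :> R by rewrite mulr_ge0// ltW.
have -> : gauss (2 * T) (x - v) = (Num.sqrt (4 * pi))^-1 * (Num.sqrt (2 * T))^-1 *
   expR (- ((x - v) ^+ 2 / (8 * T))).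
  rewrite /gauss -invfM -(sqrtrM _ pi4).
  by rewrite (_ : 4 * (2 * T) = 8 * T); [|ring].
rewrite /gauss (sqrtrM _ pi4) invfM.
have -> : (Num.sqrt t)^-1 * (expR (4 * T)^-1 * Num.sqrt (2 * T)) *
  ((Num.sqrt (4 * pi))^-1 * (Num.sqrt (2 * T))^-1 * expR (- ((x - v) ^+ 2 / (8 * T)))) =
  (Num.sqrt (4 * pi))^-1 * (Num.sqrt t)^-1 *
   (expR (4 * T)^-1 * expR (- ((x - v) ^+ 2 / (8 * T)))).
  have : Num.sqrt (2 * T) != 0 by rewrite gt_eqF// sqrtr_gt0 mulr_gt0.
  have : Num.sqrt (4 * pi) != 0 :> R by rewrite gt_eqF// sqrtr_gt0 mulr_gt0.
  have : Num.sqrt t != 0 by rewrite gt_eqF// sqrtr_gt0.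
  move: (Num.sqrt t) (Num.sqrt (4 * pi)) (Num.sqrt (2 * T)) (expR _) (expR _).
  move=> a b c e1 e2 c0 b0 a0.
  by field; rewrite ?a0 ?b0 ?c0.
apply: ler_wpM2l; first by rewrite mulr_ge0 ?invr_ge0 ?sqrtr_ge0. rewrite -expRD ler_expR.
have : x ^+ 2 / (4 * T) <= x ^+ 2 / (4 * t).
  by rewrite ler_wpM2l ?sqr_ge0// lef_pV2 ?posrE ?mulr_gt0// ler_pM2l.
have -> : x ^+ 2 / (4 * T) = (2 * x ^+ 2) / (8 * T) by field; rewrite gt_eqF.
have -> : (4 * T)^-1 = 2 / (8 * T) by field; rewrite gt_eqF.
have : (x - v) ^+ 2 / (8 * T) <= (2 * x ^+ 2 + 2) / (8 * T).
  rewrite ler_pM2r ?invr_gt0 ?mulr_gt0//; have := sqr_ge0 (x + v); nra.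
rewrite mulrDl; lra.
Qed.

Lemma heat_bound_ge0 T : 0 <= heat_bound T.
Proof. by rewrite mulr_ge0 ?expR_ge0 ?sqrtr_ge0. Qed.

(** Averaging [gauss_le] over v in [0, 1) and summing over the images bounds the
    kernel by a multiple of the mass of the kernel at time 2T, which is 1. *)
Lemma heat_series_le T t x : 0 < t -> t <= T ->
  (heat_series t x <= ((Num.sqrt t)^-1 * heat_bound T)%:E)%E.
Proof.
move=> t0 tT; have c0 : 0 <= (Num.sqrt t)^-1 * heat_bound T.
  by rewrite mulr_ge0 ?heat_bound_ge0 ?invr_ge0 ?sqrtr_ge0.
have T0 := lt_le_trans t0 tT.
have me : measurable_fun setT (fun y => heat_series (2 * T) (x - y)).
  apply: (measurableT_comp (f := fun z : R * R => heat_series z.1 z.2)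
    measurable_heat_series (g := fun y : R => (2 * T, x - y))).
  apply: measurable_fun_pair; first exact: measurable_cst.
  by apply: (@measurable_funB _ _ _ _ (cst x) id).
have -> : heat_series t x = (\int[mu]_(y in `[0%R, 1%R[) (cst (heat_series t x) y))%E.
  rewrite integral_cst//= lebesgue_measure_itv/= lte_fin ltr01 oppr0 adde0.
  by rewrite mule1.
rewrite -[leRHS]mule1 -(@integral_heat_series (2 * T) x) ?mulr_gt0//.
rewrite -ge0_integralZl//; last 2 first.
- exact: measurable_funTS.
- by move=> y _; exact: heat_series_ge0.
apply: ge0_le_integral => //.
- by move=> y _; exact: heat_series_ge0.
- by apply: measurable_funTS; apply: emeasurable_funM => //; exact: measurable_cst.
move=> y /=; rewrite in_itv/= => /andP[y0 /ltW y1].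
rewrite -nneseriesZl; last by move=> n _; rewrite lee_fin gauss_pair_ge0.
apply: lee_nneseries => [n _ _|n _]; first by rewrite lee_fin gauss_pair_ge0.
rewrite -EFinM lee_fin /gauss_pair mulrDr lerD//.
  by rewrite addrAC; exact: gauss_le.
by rewrite addrAC; exact: gauss_le.
Qed.

Lemma heat_series_fin t x : 0 < t -> heat_series t x \is a fin_num.
Proof.
move=> t0; rewrite ge0_fin_numE ?heat_series_ge0//.
by rewrite (le_lt_trans (heat_series_le _ t0 (lexx t)))// ltry.
Qed.

Lemma heat_kernel_ge0 t x : 0 <= heat_kernel t x.
Proof. by rewrite heat_kernelE fine_ge0// heat_series_ge0. Qed.

Lemma heat_kernel_heat_series t x : 0 < t -> (heat_kernel t x)%:E = heat_series t x.
Proof. by move=> t0; rewrite heat_kernelE fineK// heat_series_fin. Qed.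

Lemma heat_kernel_le0 t x : t <= 0 -> heat_kernel t x = 0.
Proof.
move=> t0; rewrite heat_kernelE /heat_series eseries0// => n _ _.
rewrite /gauss_pair /gauss ler0_sqrtr ?invr0 ?mul0r ?addr0//.
by rewrite pmulr_rle0// mulr_gt0// pi_gt0.
Qed.

Lemma integral_heat_kernel t x : 0 < t ->
  (\int[mu]_(y in `[0%R, 1%R[) (heat_kernel t (x - y))%:E = 1)%E.
Proof.
move=> t0; under eq_integral do rewrite heat_kernel_heat_series//.
exact: integral_heat_series.
Qed.

Lemma heat_kernel_le T t x : 0 < t -> t <= T ->
  heat_kernel t x <= heat_bound T / Num.sqrt t.
Proof.
move=> t0 tT; rewrite -lee_fin heat_kernel_heat_series// mulrC.
exact: heat_series_le.
Qed.

(** The prefactors have ratio sqrt (b / a), and the exponential increases with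
    time; the inequality holds image by image. *)
Lemma heat_kernel_comparison a b x : 0 < b -> b <= a ->
  Num.sqrt (b / a) * heat_kernel b x <= heat_kernel a x.
Proof.
move=> b0 ba; have a0 := lt_le_trans b0 ba.
rewrite -lee_fin EFinM !heat_kernel_heat_series//.
rewrite -nneseriesZl; last by move=> n _; rewrite lee_fin gauss_pair_ge0.
have g y : Num.sqrt (b / a) * gauss b y <= gauss a y.
  have -> : Num.sqrt (b / a) = Num.sqrt (4 * pi * b) / Num.sqrt (4 * pi * a).
    rewrite -sqrtrV ?mulr_ge0 ?pi_ge0 ?ltW// -sqrtrM ?mulr_ge0 ?pi_ge0 ?ltW//.
    by rewrite -mulf_div divff ?mul1r// gt_eqF// mulr_gt0 ?pi_gt0.
  rewrite /gauss mulrA (mulrAC (Num.sqrt _)) divff ?mul1r; last first.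
    by rewrite gt_eqF// sqrtr_gt0 !mulr_gt0// pi_gt0.
  rewrite ler_wpM2l ?invr_ge0 ?sqrtr_ge0// ler_expR lerN2.
  by rewrite ler_wpM2l ?sqr_ge0// lef_pV2 ?posrE ?mulr_gt0// ler_pM2l.
apply: lee_nneseries => [n _ _|n _].
  by rewrite -EFinM lee_fin mulr_ge0 ?gauss_pair_ge0 ?sqrtr_ge0.
by rewrite -EFinM lee_fin /gauss_pair mulrDr lerD.
Qed.

End gauss.

(** * Time increments of the heat kernel *)

Section heat_increments.
Variable R : realType.
Implicit Types t s x y a b T th : R.
Notation mu := (@lebesgue_measure R).

Lemma measurable_heat_slice t x : measurable_fun setT (fun y => heat_kernel t (x - y)).
Proof.
apply: (measurableT_comp (f := fun z : R * R => heat_kernel z.1 z.2)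
    (@measurable_heat R) (g := fun y : R => (t, x - y))).
apply: measurable_fun_pair; first exact: measurable_cst.
by apply: (@measurable_funB _ _ _ _ (cst x) id).
Qed.

(** Put r = sqrt (b / a) <= 1. From p_a >= r p_b one gets
    |p_a - p_b| <= p_a + p_b - 2 r p_b, whose integral is 2 - 2r because both
    kernels have mass 1; finally r >= r^2 = b / a. *)
Lemma heat_kernel_L1_increment a b x : 0 < b -> b <= a ->
  (\int[mu]_(y in `[0%R, 1%R[) `|heat_kernel a (x - y) - heat_kernel b (x - y)|%:E
    <= (2 * ((a - b) / a))%:E)%E.
Proof.
move=> b0 ba; have a0 := lt_le_trans b0 ba.
set r := Num.sqrt (b / a).
have r0 : 0 <= r by exact: sqrtr_ge0.
have rE : r ^+ 2 = b / a by rewrite sqr_sqrtr// divr_ge0 ?ltW.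
have r1 : r <= 1 by rewrite -(sqrtr1 R) ler_wsqrtr// ler_pdivrMr// mul1r.
have rr : b / a <= r by rewrite -rE expr2 ler_piMr.
have mh t := @measurable_heat_slice t x.
pose f y := `|heat_kernel a (x - y) - heat_kernel b (x - y)|.
have mf : measurable_fun setT f.
  by apply: measurableT_comp => //; apply: measurable_funB; exact: mh.
have i1 : (\int[mu]_(y in `[0%R, 1%R[) (f y)%:E + (2 * r)%:E <= 2%:E)%E.
  have -> : (2%:E = \int[mu]_(y in `[0%R, 1%R[)
      ((heat_kernel a (x - y))%:E + (heat_kernel b (x - y))%:E))%E.
    rewrite ge0_integralD//; last 4 first.
    - by move=> y _; rewrite lee_fin heat_kernel_ge0.
    - by apply: measurable_EFinTS; exact: mh.
    - by move=> y _; rewrite lee_fin heat_kernel_ge0.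
    - by apply: measurable_EFinTS; exact: mh.
    by rewrite !integral_heat_kernel.
  rewrite -[X in (_ + X)%E]mule1 -(integral_heat_kernel x b0).
  rewrite -ge0_integralZl_EFin//; last 3 first.
  - by move=> y _; rewrite lee_fin heat_kernel_ge0.
  - by apply: measurable_EFinTS; exact: mh.
  - by rewrite mulr_ge0.
  rewrite -ge0_integralD//; last 4 first.
  - by move=> y _; rewrite lee_fin normr_ge0.
  - by apply: measurable_EFinTS; exact: mf.
  - by move=> y _; rewrite -EFinM lee_fin !mulr_ge0 ?heat_kernel_ge0.
  - by apply: measurable_EFinTS; apply: measurable_funM; [exact: measurable_cst|exact: mh].
  apply: ge0_le_integral => //.
  - by move=> y _; rewrite -EFinM -EFinD lee_fin addr_ge0 ?mulr_ge0
      ?heat_kernel_ge0 ?normr_ge0.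
  - apply: measurable_EFinTS; apply: measurable_funD => //.
    by apply: measurable_funM; [exact: measurable_cst|exact: mh].
  - by apply: measurable_EFinTS; apply: measurable_funD; exact: mh.
  move=> y _; rewrite -EFinM -!EFinD lee_fin /f.
  have := heat_kernel_comparison (x - y) b0 ba; rewrite -/r.
  have := heat_kernel_ge0 b (x - y).
  move: (heat_kernel a _) (heat_kernel b _) => p q q0 rqp.
  have rqq : r * q <= q by rewrite ler_piMl.
  by rewrite -lerBrDr ler_norml; apply/andP; split; lra.
move: i1; rewrite -leeBrDr// => /le_trans; apply; rewrite -EFinB lee_fin.
have -> : (a - b) / a = 1 - b / a by field; rewrite gt_eqF.
lra.
Qed.

Lemma heat_kernel_L2_increment T a b x : 0 < b -> b <= a -> a <= T ->
  (\int[mu]_(y in `[0%R, 1%R[) ((heat_kernel a (x - y) - heat_kernel b (x - y)) ^+ 2)%:E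
    <= (heat_bound T / Num.sqrt b * (2 * ((a - b) / a)))%:E)%E.
Proof.
move=> b0 ba aT; have a0 := lt_le_trans b0 ba.
have mh t := @measurable_heat_slice t x.
have c0 : 0 <= heat_bound T / Num.sqrt b.
  by rewrite mulr_ge0 ?heat_bound_ge0 ?invr_ge0 ?sqrtr_ge0.
rewrite EFinM; apply: le_trans; last first.
  by apply: lee_wpmul2l; [rewrite lee_fin|exact: heat_kernel_L1_increment x b0 ba].
rewrite -ge0_integralZl_EFin//; last first.
  apply: measurable_EFinTS.
  by apply: measurableT_comp => //; apply: measurable_funB; exact: mh.
apply: ge0_le_integral => //.
- by move=> y _; rewrite lee_fin sqr_ge0.
- apply: measurable_EFinTS; apply: measurable_funX.
  by apply: measurable_funB; exact: mh.
- apply: measurable_EFinTS; apply: measurable_funM => //.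
  by apply: measurableT_comp => //; apply: measurable_funB; exact: mh.
move=> y _; rewrite -EFinM lee_fin -real_normK ?num_real// expr2 ler_wpM2r//.
have ha := heat_kernel_le (x - y) a0 aT.
have hb := heat_kernel_le (x - y) b0 (le_trans ba aT).
have hab : heat_bound T / Num.sqrt a <= heat_bound T / Num.sqrt b.
  rewrite ler_wpM2l ?heat_bound_ge0// lef_pV2 ?posrE ?sqrtr_gt0//.
  by rewrite ler_wsqrtr.
have := heat_kernel_ge0 a (x - y); have := heat_kernel_ge0 b (x - y).
move: ha hb hab; move: (heat_kernel a _) (heat_kernel b _) => p q.
move: (heat_bound T / _) (heat_bound T / _) => A B pA qB AB q0 p0.
by rewrite ler_norml; apply/andP; split; lra.
Qed.

Lemma heat_kernel_L2_le T a x : 0 < a -> a <= T ->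
  (\int[mu]_(y in `[0%R, 1%R[) (heat_kernel a (x - y) ^+ 2)%:E
    <= (heat_bound T / Num.sqrt a)%:E)%E.
Proof.
move=> a0 aT.
have mh t := @measurable_heat_slice t x.
have c0 : 0 <= heat_bound T / Num.sqrt a.
  by rewrite mulr_ge0 ?heat_bound_ge0 ?invr_ge0 ?sqrtr_ge0.
rewrite -[leRHS]mule1 -(integral_heat_kernel x a0) -ge0_integralZl_EFin//; last 2 first.
- by move=> y _; rewrite lee_fin heat_kernel_ge0.
- by apply: measurable_EFinTS; exact: mh.
apply: ge0_le_integral => //.
- by move=> y _; rewrite lee_fin sqr_ge0.
- by apply: measurable_EFinTS; apply: measurable_funX; exact: mh.
- by apply: measurable_EFinTS; apply: measurable_funM; [exact: measurable_cst|exact: mh].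
move=> y _; rewrite -EFinM lee_fin expr2 ler_wpM2r ?heat_kernel_ge0//.
exact: heat_kernel_le.
Qed.

(** The singularity (tau - r)_+^(-al) left by the time increments. *)
Definition frac_kernel (al tau r : R) : R := if r < tau then (tau - r) `^ (- al) else 0.

Lemma frac_kernel_ge0 al tau r : 0 <= frac_kernel al tau r.
Proof. by rewrite /frac_kernel; case: ifP => // _; exact: powR_ge0. Qed.

Lemma measurable_frac_kernel al tau : measurable_fun setT (frac_kernel al tau).
Proof.
apply: measurable_fun_ifT => //.
- by apply: measurable_fun_ltr.
- apply: (measurableT_comp (measurable_powR _)).
  by apply: (@measurable_funB _ _ _ _ (cst tau) id).
Qed.

Lemma is_derive_powR_sub (tau be r : R) : r < tau ->
  is_derive r (1 : R) (fun r => (tau - r) `^ be) (be * (tau - r) `^ (be - 1) * -1).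
Proof.
move=> rt.
have h1 : is_derive r (1 : R) (fun r => tau - r) (-1).
  by rewrite -[-1]add0r; apply: is_deriveB.
apply: (@is_derive1_comp R (fun y => y `^ be) (fun r => tau - r)) h1.
by apply: is_derive1_powR; rewrite subr_gt0.
Qed.

Lemma derive_frac_primitive (tau al r : R) : r < tau -> 1 - al != 0 ->
  is_derive r (1 : R) (fun r => - ((1 - al)^-1 * (tau - r) `^ (1 - al)))
    ((tau - r) `^ (- al)).
Proof.
move=> rt be0.
have h4 := is_deriveN (is_deriveZ (1 - al)^-1 (is_derive_powR_sub (1 - al) rt)).
apply: is_derive_eq h4 _.
have -> : 1 - al - 1 = - al by ring.
by rewrite /GRing.scale/=; field.
Qed.

(** The singular endpoint is cut off at distance e, with a bound uniform in e. *)
Lemma integral_frac_kernel_itv (al tau e : R) : 0 < al -> al < 1 -> 0 < e -> e <= tau ->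
  (\int[mu]_(r in `[0%R, (tau - e)%R]) (frac_kernel al tau r)%:E <=
     (tau `^ (1 - al) / (1 - al))%:E)%E.
Proof.
move=> al0 al1 e0; have be0 : 0 < 1 - al by lra.
rewrite le_eqVlt => /predU1P[->|et].
  rewrite subrr set_itv1 integral_set1 lee_fin.
  by rewrite mulr_ge0 ?powR_ge0// invr_ge0 ltW.
have D r : r < tau -> is_derive r (1 : R) (fun r => - ((1 - al)^-1 * (tau - r) `^ (1 - al)))
    (frac_kernel al tau r).
  by move=> rt; rewrite /frac_kernel rt; apply: derive_frac_primitive; rewrite // gt_eqF.
have C r : r < tau ->
    {for r, continuous (fun r => - ((1 - al)^-1 * (tau - r) `^ (1 - al)))}.
  move=> rt; apply: differentiable_continuous; apply/derivable1_diffP.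
  by have [] := D _ rt.
rewrite (@continuous_FTC2 _ _ (fun r => - ((1 - al)^-1 * (tau - r) `^ (1 - al)))).
- rewrite -EFinB lee_fin subr0 opprK addrC mulrC lerBlDr lerDl.
  by rewrite mulr_ge0 ?powR_ge0// invr_ge0 ltW.
- by rewrite subr_gt0.
- apply: (@subspace_eq_continuous _ _ _ (fun r => (tau - r) `^ (- al))).
    move=> r; rewrite inE/= in_itv/= => /andP[_ re].
    rewrite /from_subspace /frac_kernel ifT//; lra.
  apply: derivable_within_continuous => r; rewrite in_itv/= => /andP[_ re].
  have rt : r < tau by lra.
  by have [] := is_derive_powR_sub (- al) rt.
- split.
  + by move=> r; rewrite in_itv/= => /andP[_ re]; have [|dr _] := D r; [lra|exact: dr].
  + by apply: cvg_at_right_filter; apply: C; lra.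
  + by apply: cvg_at_left_filter; apply: C; lra.
- move=> r; rewrite in_itv/= => /andP[_ re]; rewrite derive1E.
  by have [|_ ->] := D r; lra.
Qed.

Lemma integral_frac_kernel (al T tau : R) : 0 < al -> al < 1 -> 0 <= tau -> tau <= T ->
  (\int[mu]_(r in `[0%R, T]) (frac_kernel al tau r)%:E <= (T `^ (1 - al) / (1 - al))%:E)%E.
Proof.
move=> al0 al1 + tT; have be0 : 0 < 1 - al by lra.
rewrite le_eqVlt => /predU1P[<-|t0].
  rewrite integral0_eq; first by rewrite lee_fin mulr_ge0 ?powR_ge0// invr_ge0 ltW.
  by move=> r; rewrite /= in_itv/= => /andP[r0 _]; rewrite /frac_kernel ltNge r0.
have tTp : (tau `^ (1 - al) / (1 - al) <= T `^ (1 - al) / (1 - al)).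
  rewrite ler_pM2r ?invr_gt0//; apply: ge0_ler_powR => //; rewrite ?nnegrE.
  - exact: ltW.
  - exact: ltW.
  - by rewrite ltW// (lt_le_trans t0).
apply: (@le_trans _ _ (tau `^ (1 - al) / (1 - al))%:E); last by rewrite lee_fin.
pose F (n : nat) : set R := [set` `[0, tau - tau / n.+1%:R]].
have mp D : measurable_fun D (fun r => (frac_kernel al tau r)%:E).
  by apply: measurable_EFinTS; exact: measurable_frac_kernel.
have -> : (\int[mu]_(r in `[0%R, T]) (frac_kernel al tau r)%:E =
           \int[mu]_(r in \bigcup_n F n) (frac_kernel al tau r)%:E)%E.
  rewrite integral_mkcond [RHS]integral_mkcond; apply: eq_integral => r _.
  rewrite /patch; case: ifPn => [|]; rewrite ?notin_setE ?inE/=.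
    rewrite in_itv/= => /andP[r0 rT]; case: ifPn => //; rewrite notin_setE => nF.
    rewrite /frac_kernel; case: ifPn => // rt; exfalso; apply: nF.
    have := real_truncnS_gt (num_real (tau / (tau - r))).
    exists (Num.truncn (tau / (tau - r))) => //; rewrite /F/= in_itv/= r0/=.
    rewrite lerBrDr -lerBrDl ler_pdivrMr// mulrC -ler_pdivrMr ?subr_gt0//.
    exact: ltW.
  move=> rI; case: ifPn => //; rewrite inE => -[n _]; rewrite /F/= in_itv/= => /andP[r0 rn].
  exfalso; apply: rI; rewrite in_itv/= r0/= (le_trans rn)// (le_trans _ tT)//.
  by rewrite lerBlDr lerDl divr_ge0// ltW.
have cv : (\int[mu]_(r in F n) (frac_kernel al tau r)%:E @[n --> \oo] -->
           \int[mu]_(r in \bigcup_n F n) (frac_kernel al tau r)%:E)%E.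
  apply: ge0_nondecreasing_set_cvg_integral => //.
  - apply/nondecreasing_seqP => n; apply/subsetPset => r; rewrite /F/= !in_itv/=.
    move=> /andP[-> rn]/=; rewrite (le_trans rn)// lerD2l lerN2 ler_pM2l//.
    by rewrite lef_pV2 ?posrE// ler_nat.
  - by move=> n; rewrite /F; exact: measurable_itv.
  - by move=> n; exact: mp.
  - by move=> n r _; rewrite lee_fin frac_kernel_ge0.
rewrite -(cvg_lim (@ereal_hausdorff _) cv); apply: lime_le.
  by apply/cvg_ex; eexists; exact: cv.
apply: nearW => n; apply: integral_frac_kernel_itv; rewrite ?divr_gt0//.
by rewrite ler_pdivrMr// ler_peMr ?ler1n// ltW.
Qed.

(** The kernel of both convolutions. It vanishes for times after t, so that
    all of them can be integrated over the same cylinder. *)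
Definition hker t x (z : R * R) : R := heat_kernel (t - z.1) (x - z.2).

Lemma measurable_hker t x : measurable_fun setT (hker t x).
Proof.
apply: (measurableT_comp (f := fun z : R * R => heat_kernel z.1 z.2)
    (@measurable_heat R) (g := fun z : R * R => (t - z.1, x - z.2))).
apply: measurable_fun_pair.
  by apply: (@measurable_funB _ _ _ _ (cst t) fst) => //; exact: measurable_fst.
by apply: (@measurable_funB _ _ _ _ (cst x) snd) => //; exact: measurable_snd.
Qed.

Lemma measurable_cylinder T : measurable (cylinder T : set (R * R)).
Proof. by apply: measurableX; exact: measurable_itv. Qed.

Lemma cylinder_finite T : (leb2 R (cylinder T : set (R * R)) < +oo)%E.
Proof.
rewrite /cylinder /torus product_measure1E/=; [|exact: measurable_itv..].
rewrite !lebesgue_measure_itv/= !lte_fin ltr01 !oppr0 !adde0 mule1.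
by case: ifPn => _; rewrite ?ltry// -EFinB ltry.
Qed.

Lemma cylinder_subset t T : t <= T -> cylinder t `<=` (cylinder T : set (R * R)).
Proof.
move=> tT z [/=]; rewrite !in_itv/= => /andP[z0 zt] zx.
by split => //=; rewrite in_itv/= z0/= (le_trans zt).
Qed.

Lemma integral_cylinder T (F : R * R -> \bar R) :
  measurable_fun setT F -> (forall z, 0 <= F z)%E ->
  (\int[leb2 R]_(z in cylinder T) F z =
   \int[mu]_(r in `[0%R, T]) \int[mu]_(y in `[0%R, 1%R[) F (r, y))%E.
Proof.
move=> mF F0; rewrite integral_mkcond fubini_tonelli1; last 2 first.
- apply/(measurable_restrictT _ _).1; first exact: measurable_cylinder.
  exact: measurable_funTS.
- by move=> z; exact: erestrict_ge0.
rewrite [RHS]integral_mkcond; apply: eq_integral => r _; rewrite /fubini_F.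
rewrite [RHS]/patch; case: ifPn => [|]; rewrite ?notin_setE ?inE/= => rI.
  rewrite [RHS]integral_mkcond; apply: eq_integral => y _.
  rewrite /patch /cylinder /torus; congr (if _ then _ else _).
  by apply/idP/idP; rewrite !inE/= => // -[].
apply: integral0_eq => y _; rewrite /patch; case: ifPn => //.
by rewrite inE /cylinder/= => -[].
Qed.

Lemma measurable_fiber (F : R * R -> \bar R) :
  measurable_fun setT F -> (forall z, 0 <= F z)%E ->
  measurable_fun setT (fun r => \int[mu]_(y in `[0%R, 1%R[) F (r, y))%E.
Proof.
move=> mF F0; pose G := F \_ (setT `*` `[0%R, 1%R[).
have mD : measurable ([set: R] `*` `[(0:R), 1[) by exact: measurableX.
have mG : measurable_fun setT G.
  by apply/(measurable_restrictT _ _).1 => //; exact: measurable_funTS.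
have := @measurable_fun_fubini_tonelli_F _ _ _ _ R mu G mG.
rewrite (_ : fubini_F mu G = (fun r => \int[mu]_(y in `[0%R, 1%R[) F (r, y))%E).
  by apply => z; exact: erestrict_ge0.
apply/funext => r; rewrite /fubini_F [RHS]integral_mkcond; apply: eq_integral => y _.
rewrite /G /patch; congr (if _ then _ else _).
by apply/idP/idP; rewrite !inE/= => // -[].
Qed.

Lemma le_integral_cylinder T (F : R * R -> \bar R) (g : R -> R) :
  measurable_fun setT F -> (forall z, 0 <= F z)%E -> measurable_fun setT g ->
  (forall r, 0 <= r -> r <= T ->
    (\int[mu]_(y in `[0%R, 1%R[) F (r, y) <= (g r)%:E)%E) ->
  (\int[leb2 R]_(z in cylinder T) F z <= \int[mu]_(r in `[0%R, T]) (g r)%:E)%E.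
Proof.
move=> mF F0 mg Fg; rewrite integral_cylinder//; apply: ge0_le_integral => //.
- by move=> r _; exact: integral_ge0.
- by apply: measurable_funTS; exact: measurable_fiber.
- by apply: measurable_EFinTS; exact: mg.
- by move=> r /=; rewrite in_itv/= => /andP[? ?]; exact: Fg.
Qed.

Lemma le_powR_unit (q th : R) : 0 <= q -> q <= 1 -> 0 < th -> th <= 1 ->
  q <= q `^ th.
Proof.
rewrite le_eqVlt => /predU1P[<- _ th0 _|q0 q1 th0 th1].
  by rewrite powR_ge0.
by rewrite -[leLHS]powRr1 ?(ltW q0)// ger_powR// q0.
Qed.

Lemma hker_pair t x r y : hker t x (r, y) = heat_kernel (t - r) (x - y).
Proof. by []. Qed.

Lemma hker_out t x r y : t <= r -> hker t x (r, y) = 0.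
Proof. by move=> tr; rewrite /hker/= heat_kernel_le0// subr_le0. Qed.

(** Truncation at time t is already encoded in the kernel, which is what makes
    increments in t comparable over the fixed cylinder of height T. *)
Lemma cylinder_hker t T x z : t <= T ->
  \1_(cylinder t) z * hker t x z = \1_(cylinder T) z * hker t x z.
Proof.
move=> tT; rewrite !indicE.
have [zt|zt] := boolP (z \in cylinder t).
  by rewrite (_ : z \in cylinder T)// inE; apply: cylinder_subset tT _ _; rewrite -inE.
have [zT|//] := boolP (z \in cylinder T); rewrite mul0r mul1r.
rewrite /hker heat_kernel_le0// subr_le0 leNgt.
apply: contra zt => zt; move: zT; rewrite !inE /cylinder/= !in_itv/=.
by move=> -[/andP[-> _] zx]; split => //; exact: ltW.
Qed.

(** Before time s both kernels are alive and their L1 distance is at most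
    2 (t-s)/(t-r) <= 2 ((t-s)/(t-r))^th; between s and t only one is, of mass
    1 <= ((t-s)/(t-r))^th. Both regimes are governed by (t-r)^(-th), which is
    integrable. *)
Lemma hker_L1_increment T s t x th : 0 <= s -> s <= t -> t <= T -> 0 < th -> th < 1 ->
  (\int[leb2 R]_(z in cylinder T) `|hker t x z - hker s x z|%:E <=
   (2 * T `^ (1 - th) / (1 - th) * (t - s) `^ th)%:E)%E.
Proof.
move=> s0 st tT th0 th1; have T0 := le_trans s0 (le_trans st tT).
have h0 : 0 <= t - s by rewrite subr_ge0.
have c0 : 0 <= 2 * (t - s) `^ th by rewrite mulr_ge0 ?powR_ge0.
apply: (@le_trans _ _ (\int[mu]_(r in `[0%R, T])
    (2 * (t - s) `^ th * frac_kernel th t r)%:E)%E).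
  apply: le_integral_cylinder => //.
  - apply: measurable_EFinTS; apply: measurableT_comp => //.
    by apply: measurable_funB; exact: measurable_hker.
  - by apply: measurable_funM; [exact: measurable_cst|exact: measurable_frac_kernel].
  move=> r r0 rT; rewrite /frac_kernel; case: ltP => rt; last first.
    rewrite integral0_eq ?mulr0// => y _.
    by rewrite !hker_out// ?subrr ?normr0// (le_trans st).
  have tr0 : 0 < t - r by rewrite subr_gt0.
  have [rs|sr] := ltP r s.
    have sr0 : 0 < s - r by rewrite subr_gt0.
    have sr : s - r <= t - r by rewrite lerD2r.
    under eq_integral do rewrite !hker_pair.
    apply: (le_trans (heat_kernel_L1_increment x sr0 sr)).
    rewrite lee_fin -mulrA ler_pM2l//.
    rewrite (_ : t - r - (s - r) = t - s); last by ring.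
    rewrite powRN -(powR_inv1 (ltW tr0)).
    apply: (le_trans (le_powR_unit _ _ th0 (ltW th1))).
    - by rewrite mulr_ge0// powR_ge0.
    - by rewrite powR_inv1 ?(ltW tr0)// ler_pdivrMr// mul1r; lra.
    by rewrite powRM// ?powR_ge0// -!powRrM mulN1r powRN.
  under eq_integral do rewrite (hker_out _ _ sr) subr0 hker_pair
    ger0_norm ?heat_kernel_ge0//.
  rewrite (integral_heat_kernel x tr0) lee_fin.
  have : 1 <= (t - s) `^ th * (t - r) `^ (- th).
    rewrite powRN ler_pdivlMr ?powR_gt0// mul1r; apply: ge0_ler_powR => //.
    - exact: ltW.
    - by rewrite nnegrE ltW.
    - by rewrite lerD2l lerN2.
  lra.
under eq_integral do rewrite EFinM.
rewrite ge0_integralZl_EFin//; last 2 first.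
- by move=> r _; rewrite lee_fin frac_kernel_ge0.
- by apply: measurable_EFinTS; exact: measurable_frac_kernel.
apply: (@le_trans _ _ ((2 * (t - s) `^ th)%:E * (T `^ (1 - th) / (1 - th))%:E)%E).
  apply: lee_wpmul2l; first by rewrite lee_fin.
  by apply: integral_frac_kernel => //; rewrite (le_trans s0).
by rewrite -EFinM lee_fin le_eqVlt; apply/orP; left; apply/eqP; ring.
Qed.

Definition hker_L2_const T th := 4 * heat_bound T * T `^ (2^-1 - th) / (2^-1 - th).

(** As for the L1 norm, with the additional factor 1/sqrt coming from the sup
    bound: the singularities are now of order 1/2 + th < 1, at s and at t. *)
Lemma hker_L2_increment T s t x th : 0 <= s -> s <= t -> t <= T ->
  0 < th -> th < 2^-1 ->
  (\int[leb2 R]_(z in cylinder T) ((hker t x z - hker s x z) ^+ 2)%:E <=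
   (hker_L2_const T th * (t - s) `^ th)%:E)%E.
Proof.
rewrite /hker_L2_const.
move=> s0 st tT th0 th1; have T0 := le_trans s0 (le_trans st tT).
have h0 : 0 <= t - s by rewrite subr_ge0.
have M0 := heat_bound_ge0 T.
have c0 : 0 <= 2 * heat_bound T * (t - s) `^ th by rewrite !mulr_ge0 ?powR_ge0.
set al := 2^-1 + th.
have al0 : 0 < al by rewrite /al; lra.
have al1 : al < 1 by rewrite /al; lra.
have powal a : 0 < a -> a `^ (- al) = (Num.sqrt a)^-1 * a `^ (- th).
  move=> a0; rewrite /al opprD powRD; last by apply/implyP => _; rewrite gt_eqF.
  by rewrite [X in X * _]powRN powR12_sqrt ?ltW.
apply: (@le_trans _ _ (\int[mu]_(r in `[0%R, T])
    ((2 * heat_bound T * (t - s) `^ th) * (frac_kernel al s r + frac_kernel al t r))%:E)%E).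
  apply: le_integral_cylinder => //.
  - apply: measurable_EFinTS; apply: measurable_funX.
    by apply: measurable_funB; exact: measurable_hker.
  - by move=> z; rewrite lee_fin sqr_ge0.
  - apply: measurable_funM; first exact: measurable_cst.
    by apply: measurable_funD; exact: measurable_frac_kernel.
  move=> r r0 rT; have [rt|tr] := ltP r t; last first.
    rewrite integral0_eq; first by rewrite lee_fin mulr_ge0// addr_ge0 ?frac_kernel_ge0.
    by move=> y _; rewrite !hker_out// ?subrr ?expr0n// (le_trans st).
  have tr0 : 0 < t - r by rewrite subr_gt0.
  have trT : t - r <= T by lra.
  have [rs|sr] := ltP r s.
    have sr0 : 0 < s - r by rewrite subr_gt0.
    have sr : s - r <= t - r by rewrite lerD2r.
    under eq_integral do rewrite !hker_pair.
    apply: (le_trans (heat_kernel_L2_increment x sr0 sr trT)); rewrite lee_fin.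
    apply: (@le_trans _ _ (2 * heat_bound T * (t - s) `^ th *
      frac_kernel al s r)); last first.
      by rewrite ler_wpM2l// lerDl frac_kernel_ge0.
    rewrite /frac_kernel rs powal//.
    have -> : heat_bound T / Num.sqrt (s - r) * (2 * ((t - r - (s - r)) / (t - r))) =
      2 * heat_bound T / Num.sqrt (s - r) * ((t - s) / (t - r)).
      by rewrite (_ : t - r - (s - r) = t - s); ring.
    have -> : 2 * heat_bound T * (t - s) `^ th * ((Num.sqrt (s - r))^-1 * (s - r) `^ (- th))
      = 2 * heat_bound T / Num.sqrt (s - r) * ((t - s) `^ th * (s - r) `^ (- th)) by ring.
    rewrite ler_wpM2l ?mulr_ge0 ?invr_ge0 ?sqrtr_ge0//.
    apply: (le_trans (le_powR_unit _ _ th0 _)).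
    - by rewrite mulr_ge0// invr_ge0 ltW.
    - by rewrite ler_pdivrMr// mul1r; lra.
    - by lra.
    rewrite -powR_inv1 ?(ltW tr0)// powRM// ?powR_ge0// -!powRrM mulN1r.
    rewrite ler_wpM2l ?powR_ge0// !powRN lef_pV2 ?posrE ?powR_gt0//.
    by apply: ge0_ler_powR => //; rewrite ?nnegrE ltW.
  under eq_integral do rewrite (hker_out _ _ sr) subr0 hker_pair.
  apply: (le_trans (heat_kernel_L2_le x tr0 trT)); rewrite lee_fin.
  apply: (@le_trans _ _ (2 * heat_bound T * (t - s) `^ th *
      frac_kernel al t r)); last first.
    by rewrite ler_wpM2l// lerDr frac_kernel_ge0.
  rewrite /frac_kernel rt powal//.
  have -> : 2 * heat_bound T * (t - s) `^ th * ((Num.sqrt (t - r))^-1 * (t - r) `^ (- th))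
      = heat_bound T / Num.sqrt (t - r) * (2 * ((t - s) `^ th * (t - r) `^ (- th))) by ring.
  rewrite ler_peMr ?mulr_ge0 ?invr_ge0 ?sqrtr_ge0//.
  have : 1 <= (t - s) `^ th * (t - r) `^ (- th).
    rewrite powRN ler_pdivlMr ?powR_gt0// mul1r; apply: ge0_ler_powR => //.
    - exact: ltW.
    - by rewrite nnegrE ltW.
    - by rewrite lerD2l lerN2.
  lra.
under eq_integral do rewrite EFinM EFinD.
have mp tau : measurable_fun `[0, T] (fun r => (frac_kernel al tau r)%:E).
  by apply: measurable_EFinTS; exact: measurable_frac_kernel.
rewrite ge0_integralZl_EFin//; last 2 first.
- by move=> r _; rewrite -EFinD lee_fin addr_ge0 ?frac_kernel_ge0.
- by apply: emeasurable_funD; exact: mp.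
rewrite ge0_integralD; [|exact: measurable_itv
  |by move=> r _; rewrite lee_fin frac_kernel_ge0|exact: mp
  |by move=> r _; rewrite lee_fin frac_kernel_ge0|exact: mp].
have al' : 2^-1 - th = 1 - al by rewrite /al; field.
apply: (@le_trans _ _ ((2 * heat_bound T * (t - s) `^ th)%:E *
   ((T `^ (1 - al) / (1 - al))%:E + (T `^ (1 - al) / (1 - al))%:E))%E).
  apply: lee_wpmul2l; first by rewrite lee_fin.
  by apply: leeD; apply: integral_frac_kernel => //;
    [exact: (le_trans st)|exact: (le_trans s0)].
by rewrite -EFinD -EFinM lee_fin le_eqVlt al'; apply/orP; left; apply/eqP; ring.
Qed.

End heat_increments.

(** * Kolmogorov's continuity criterion *)

Section chaining.
Variable R : realType.
Implicit Types (t s T M q gam del : R) (f g : R -> R).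

(** The sequences u n + K q^n and u n - K q^n, with K = M q / (1 - q), are
    monotone and enclose u n; their common limit comes with the rate. *)
Lemma geometric_increments_cvg (u : R^nat) (M q : R) : 0 <= M -> 0 < q -> q < 1 ->
  (forall n, `|u n.+1 - u n| <= M * q ^+ n.+1) ->
  exists2 l, u @ \oo --> l & forall n, `|l - u n| <= M * q / (1 - q) * q ^+ n.
Proof.
move=> M0 q0 q1 du; set K := M * q / (1 - q).
have q1' : 0 < 1 - q by rewrite subr_gt0.
have K0 : 0 <= K by rewrite !mulr_ge0 ?invr_ge0// ltW.
have KE : M * q + K * q = K by rewrite /K; field; rewrite gt_eqF.
pose a n := u n + K * q ^+ n; pose b n := u n - K * q ^+ n.
have step n : K * q ^+ n - K * q ^+ n.+1 = M * q ^+ n.+1.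
  transitivity ((K - K * q) * q ^+ n); first by rewrite exprS; ring.
  by rewrite -{1}KE addrK exprS; ring.
have na : nonincreasing_seq a.
  apply/nonincreasing_seqP => n; rewrite /a.
  by have := du n; rewrite ler_norml => /andP[_]; have := step n; lra.
have nb : nondecreasing_seq b.
  apply/nondecreasing_seqP => n; rewrite /b.
  by have := du n; rewrite ler_norml => /andP[+ _]; have := step n; lra.
have ba n : b n <= a n.
  have : 0 <= K * q ^+ n by rewrite mulr_ge0// exprn_ge0// ltW.
  by rewrite /a /b; lra.
have ca : cvgn a.
  apply: nonincreasing_is_cvgn => //; exists (b 0%N) => _ [n _ <-].
  by rewrite (le_trans _ (ba n))// nb.
have cq : K * q ^+ n @[n --> \oo] --> (0 : R).
  by have := @cvg_geometric _ K q; rewrite ger0_norm ?(ltW q0)//; exact.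
have cu : u @ \oo --> limn a.
  have -> : u = a \- (fun n => K * q ^+ n) by apply/funext => n; rewrite /a/= addrK.
  by rewrite -[X in _ --> X]subr0; apply: cvgB.
have cb : b @ \oo --> limn a.
  by rewrite -[X in _ --> X]subr0; apply: cvgB.
exists (limn a) => // n; rewrite ler_norml; apply/andP; split.
  have : b n <= limn b.
    by apply: nondecreasing_cvgn_le => //; apply/cvg_ex; eexists; exact: cb.
  by rewrite (cvg_lim _ cb)// /b; lra.
have : limn a <= a n by exact: nonincreasing_cvgn_ge.
by rewrite /a; lra.
Qed.

Lemma powR2_lt1 (x : R) : x < 0 -> 2 `^ x < 1 :> R.
Proof.
move=> x0; rewrite /powR pnatr_eq0/= -[ltRHS]expR0 ltr_expR.
by rewrite pmulr_llt0// ln_gt0// ltr1n.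
Qed.

(** The dyadic points of [0, T], and the index of the last one of level n
    that does not exceed t. *)
Definition dyad T (n i : nat) : R := i%:R * T / 2 ^+ n.
Definition dindex T (n : nat) t : nat := Num.truncn (2 ^+ n * t / T).

Lemma dyadS T n i : dyad T n.+1 i.*2 = dyad T n i.
Proof.
rewrite /dyad exprS -muln2 natrM; field.
by rewrite expf_eq0 pnatr_eq0 andbF.
Qed.

Lemma dindexP T n t : 0 < T -> 0 <= t ->
  ((dindex T n t)%:R <= 2 ^+ n * t / T) /\ (2 ^+ n * t / T < (dindex T n t).+1%:R).
Proof.
move=> T0 t0; have : 0 <= 2 ^+ n * t / T by rewrite divr_ge0 ?mulr_ge0 ?exprn_ge0// ltW.
by move=> /truncn_itv /andP[].
Qed.

Lemma dindex_le T n t : 0 < T -> 0 <= t -> t <= T -> (dindex T n t <= 2 ^ n)%N.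
Proof.
move=> T0 t0 tT; have [h _] := dindexP n T0 t0.
rewrite -(ler_nat R) (le_trans h)// natrX ler_pdivrMr// ler_wpM2l ?exprn_ge0//.
Qed.

Lemma dyad_dindex T n t : 0 < T -> 0 <= t ->
  dyad T n (dindex T n t) <= t /\ t - dyad T n (dindex T n t) <= T / 2 ^+ n.
Proof.
move=> T0 t0; have [h1 h2] := dindexP n T0 t0.
have p0 : 0 < 2 ^+ n :> R by rewrite exprn_gt0.
rewrite /dyad; split.
  by rewrite ler_pdivrMr// -ler_pdivlMr// (mulrC t).
rewrite ler_pdivlMr// mulrBl divfK ?gt_eqF// lerBlDl -[X in _ + X]mul1r -mulrDl natr1 mulrC.
by rewrite -ler_pdivrMr// ltW.
Qed.

Lemma dyad_itv T n i : 0 < T -> (i <= 2 ^ n)%N -> 0 <= dyad T n i /\ dyad T n i <= T.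
Proof.
move=> T0 i2; have p0 : 0 < 2 ^+ n :> R by rewrite exprn_gt0.
split; first by rewrite /dyad !mulr_ge0 ?invr_ge0// ltW.
by rewrite /dyad ler_pdivrMr// mulrC ler_pM2l// -natrX ler_nat.
Qed.

Lemma dindexS T n t : 0 < T -> 0 <= t ->
  dindex T n.+1 t = (dindex T n t).*2 \/ dindex T n.+1 t = (dindex T n t).*2.+1.
Proof.
move=> T0 t0; have [h1 h2] := dindexP n T0 t0; have [] := dindexP n.+1 T0 t0.
rewrite exprS -!mulrA; move: h1 h2; rewrite -!mulrA; move: (2 ^+ n * (t / T)) => x.
move: (dindex T n t) (dindex T n.+1 t) => i j ix xi jx xj.
have : (i.*2 < j.+1)%N.
  by rewrite -(ltr_nat R) (le_lt_trans _ xj)// -muln2 natrM mulrC ler_pM2l.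
have : (j < i.+1.*2)%N.
  by rewrite -(ltr_nat R) (le_lt_trans jx)// -muln2 natrM mulrC ltr_pM2r.
rewrite ltnS doubleS => ji ij; have [->|/eqP jn] := eqVneq j i.*2; first by left.
by right; lia.
Qed.

Lemma dyadic_scale T h : 0 < h -> h <= T ->
  exists n, T / 2 ^+ n.+1 < h /\ h <= T / 2 ^+ n.
Proof.
move=> h0 hT; have x1 : 1 <= T / h by rewrite ler_pdivlMr// mul1r.
have /truncn_itv/andP[m1 m2] : 0 <= T / h by rewrite (le_trans _ x1).
set m := Num.truncn (T / h) in m1 m2.
have m0 : (0 < m)%N.
  by rewrite lt0n; apply/eqP => m0; move: m2; rewrite m0; lra.
have /andP[k1 k2] := trunc_log_bounds (isT : (1 < 2)%N) m0.
exists (trunc_log 2 m); move: (trunc_log 2 m) k1 k2 => k k1 k2.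
split.
  rewrite ltr_pdivrMr ?exprn_gt0// mulrC -ltr_pdivrMr// (lt_le_trans m2)//.
  by rewrite -natrX ler_nat.
rewrite ler_pdivlMr ?exprn_gt0// mulrC -ler_pdivlMr// (le_trans _ m1)//.
by rewrite -natrX ler_nat.
Qed.

(** The finitely many levels below N are absorbed in the constant. *)
Lemma dyadic_increments_bound T g q N : 0 < q ->
  (forall n i, (N <= n)%N -> (i < 2 ^ n)%N ->
     `|g (dyad T n i.+1) - g (dyad T n i)| <= q ^+ n) ->
  exists2 M, 0 <= M & forall n i, (i < 2 ^ n)%N ->
     `|g (dyad T n i.+1) - g (dyad T n i)| <= M * q ^+ n.
Proof.
move=> q0 H; pose D n i := `|g (dyad T n i.+1) - g (dyad T n i)|.
pose S := \sum_(n < N) \sum_(i < 2 ^ n) D n i / q ^+ n.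
have D0 n i : 0 <= D n i / q ^+ n.
  by rewrite mulr_ge0 ?normr_ge0// invr_ge0 exprn_ge0// ltW.
have S0 : 0 <= S by do 2 apply: sumr_ge0 => ? _.
exists (1 + S); first by rewrite addr_ge0.
move=> n i i2; have qn0 : 0 < q ^+ n by rewrite exprn_gt0.
have [Nn|nN] := leqP N n.
  by rewrite (le_trans (H _ _ Nn i2))// ler_peMl ?(ltW qn0)// lerDl.
rewrite -ler_pdivrMr// -/(D n i) ler_wpDl//.
rewrite /S (bigD1 (Ordinal nN))//= (bigD1 (Ordinal i2))//= -addrA lerDl addr_ge0//.
  by apply: sumr_ge0 => ? _.
by do 2 apply: sumr_ge0 => ? _.
Qed.

(** Chaining: the values at the dyadic approximations of t from below form a
    sequence with geometric increments. Two points at distance of order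
    T / 2^n have equal or neighbouring approximations at level n, and both are
    within q^n of their limits. *)
Lemma dyadic_hoelder T g gam N : 0 < T -> 0 < gam ->
  (forall n i, (N <= n)%N -> (i < 2 ^ n)%N ->
     `|g (dyad T n i.+1) - g (dyad T n i)| <= (2 `^ (- gam)) ^+ n) ->
  exists G : R -> R,
    (forall t, 0 <= t -> t <= T -> g (dyad T n (dindex T n t)) @[n --> \oo] --> G t) /\
    hoelder_on `[0, T] gam G.
Proof.
move=> T0 gam0; set q := 2 `^ (- gam).
have q0 : 0 < q by exact: powR_gt0.
have q1 : q < 1 by apply: powR2_lt1; rewrite oppr_lt0.
move=> /(dyadic_increments_bound q0)[M M0 inc].
pose u t n := g (dyad T n (dindex T n t)).
have du t n : 0 <= t -> t <= T -> `|u t n.+1 - u t n| <= M * q ^+ n.+1.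
  move=> t0 tT; have Mq : 0 <= M * q ^+ n.+1 by rewrite mulr_ge0// exprn_ge0// ltW.
  rewrite /u -(dyadS T n); have [->|e] := dindexS n T0 t0; first by rewrite subrr normr0.
  by rewrite e; apply: inc; rewrite -e; exact: dindex_le.
have cv t : {l | 0 <= t -> t <= T -> u t @ \oo --> l /\
     forall n, `|l - u t n| <= M * q / (1 - q) * q ^+ n}.
  apply: cid; have [t0|] := boolP (0 <= t); last by exists 0.
  have [tT|] := boolP (t <= T); last by exists 0.
  have [l cl hl] := geometric_increments_cvg M0 q0 q1 (fun n => du t n t0 tT).
  by exists l.
pose G t := projT1 (cv t).
have Gc t : 0 <= t -> t <= T -> u t @ \oo --> G t.
  by move=> t0 tT; rewrite /G; case: (cv t) => l /= /(_ t0 tT)[].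
have Gb t n : 0 <= t -> t <= T -> `|G t - u t n| <= M * q / (1 - q) * q ^+ n.
  by move=> t0 tT; rewrite /G; case: (cv t) => l /= /(_ t0 tT)[].
exists G; split=> //.
set K := M * q / (1 - q) in Gb.
have K0 : 0 <= K by rewrite !mulr_ge0 ?invr_ge0 ?subr_ge0// ltW.
exists ((2 * K + M) * (2 / T) `^ gam).
suff main s t : 0 <= s -> s < t -> t <= T ->
    `|G t - G s| <= (2 * K + M) * (2 / T) `^ gam * (t - s) `^ gam.
  move=> s t /=; rewrite !in_itv/= => /andP[s0 sT] /andP[t0 tT].
  have [st|ts|->] := ltgtP s t.
  - by rewrite (gtr0_norm (_ : 0 < t - s)) ?subr_gt0//; exact: main.
  - by rewrite distrC (distrC t) (gtr0_norm (_ : 0 < s - t)) ?subr_gt0//; exact: main.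
  - by rewrite !subrr !normr0 !mulr_ge0 ?powR_ge0// addr_ge0// mulr_ge0.
move=> s0 st tT; have t0 : 0 <= t by rewrite (le_trans s0)// ltW.
have sT : s <= T by rewrite (le_trans _ tT)// ltW.
have [n [n1 n2]] : exists n, T / 2 ^+ n.+1 < t - s /\ t - s <= T / 2 ^+ n.
  by apply: dyadic_scale; lra.
have p0 : 0 < 2 ^+ n :> R by rewrite exprn_gt0.
have close : `|u t n - u s n| <= M * q ^+ n.
  have : (dindex T n s <= dindex T n t <= (dindex T n s).+1)%N.
    have [ix xi] := dindexP n T0 s0; have [jx xj] := dindexP n T0 t0.
    have xy : 2 ^+ n * t / T <= 2 ^+ n * s / T + 1.
      rewrite -lerBlDl -mulrBl -mulrBr ler_pdivrMr// mul1r mulrC.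
      by move: n2; rewrite ler_pdivlMr.
    have yx : 2 ^+ n * s / T <= 2 ^+ n * t / T.
      by rewrite ler_pM2r ?invr_gt0// ler_pM2l// ltW.
    rewrite -ltnS -(ltr_nat R) (le_lt_trans (le_trans ix yx) xj)/=.
    rewrite -ltnS -(ltr_nat R) (le_lt_trans jx)// (le_lt_trans xy)//.
    by rewrite -[X in _ < X]natr1 ltrD2r.
  rewrite leq_eqVlt => /andP[/predU1P[e _|]].
    by rewrite /u e subrr normr0 mulr_ge0// exprn_ge0// ltW.
  move=> + h; rewrite ltnNge => /negP lt1.
  have e : dindex T n t = (dindex T n s).+1.
    by apply/eqP; rewrite eqn_leq h/= ltnNge; apply/negP.
  rewrite /u e; apply: inc; rewrite -e; exact: dindex_le.
have qn : q ^+ n <= (2 / T) `^ gam * (t - s) `^ gam.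
  rewrite /q -powR_mulrn ?powR_ge0// -powRrM.
  rewrite (_ : - gam * n%:R = - n%:R * gam); last by ring.
  rewrite powRrM powR_invn// -powRM ?divr_ge0 ?subr_ge0 ?(ltW st) ?(ltW T0)//.
  have h0 : 0 <= 2 / T * (t - s).
    by rewrite mulr_ge0 ?divr_ge0 ?subr_ge0 ?(ltW st) ?(ltW T0).
  apply: ge0_ler_powR; rewrite ?nnegrE ?invr_ge0 ?(ltW p0) ?(ltW gam0)//.
  move: n1; rewrite exprS ltr_pdivrMr ?mulr_gt0// => n1.
  rewrite -(ler_pM2r p0) mulVf ?gt_eqF// -(ler_pM2r T0) mul1r.
  have -> : 2 / T * (t - s) * 2 ^+ n * T = (t - s) * (2 * 2 ^+ n) by field; rewrite gt_eqF.
  exact: ltW.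
apply: (@le_trans _ _ ((2 * K + M) * q ^+ n)); last first.
  by rewrite -mulrA ler_wpM2l// addr_ge0// mulr_ge0.
have := Gb t n t0 tT; have := Gb s n s0 sT.
move: close; rewrite !ler_norml => /andP[? ?] /andP[? ?] /andP[? ?].
by apply/andP; split; lra.
Qed.

Lemma hoelder_on_le T gam del g : 0 <= T -> 0 < del -> del <= gam ->
  hoelder_on `[0, T] gam g -> hoelder_on `[0, T] del g.
Proof.
move=> T0 del0 dg [C hC]; exists (`|C| * T `^ (gam - del)) => s t Ds Dt.
apply: (le_trans (hC s t Ds Dt)).
have dg0 : 0 <= gam - del by rewrite subr_ge0.
have -> : `|t - s| `^ gam = `|t - s| `^ (gam - del) * `|t - s| `^ del.
  rewrite -powRD ?subrK//; apply/implyP => /eqP e; exfalso; lra.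
rewrite mulrA ler_wpM2r ?powR_ge0//.
apply: (@le_trans _ _ (`|C| * `|t - s| `^ (gam - del))).
  by rewrite ler_wpM2r ?powR_ge0// ler_norm.
rewrite ler_wpM2l//; apply: ge0_ler_powR; rewrite ?nnegrE//.
move: Ds Dt; rewrite /= !in_itv/= => /andP[? ?] /andP[? ?].
by rewrite ler_norml; apply/andP; split; lra.
Qed.

Lemma hoelder_onD (D : set R) del f g : hoelder_on D del f -> hoelder_on D del g ->
  hoelder_on D del (fun t => f t + g t).
Proof.
move=> [C hC] [K hK]; exists (C + K) => s t Ds Dt.
rewrite mulrDl opprD addrACA (le_trans (ler_normD _ _))// lerD//.
  exact: hC.
exact: hK.
Qed.

End chaining.

Section kolmogorov.
Context (R : realType) (d : measure_display) (Omega : measurableType d)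
        (P : probability Omega R).
Implicit Types (T gam a b C : R) (Z : R -> {RV P >-> R}).

Lemma borel_cantelli_geometric (A : (set Omega)^nat) (C r : R) :
  0 <= C -> 0 < r -> r < 1 -> (forall n, measurable (A n)) ->
  (forall n, P (A n) <= (C * r ^+ n)%:E)%E ->
  {ae P, forall w, exists N, forall n, (N <= n)%N -> ~ A n w}.
Proof.
move=> C0 r0 r1 mA PA.
have PS : P (lim_sup_set A) = 0.
  apply: lim_sup_set_cvg0 => //.
  apply: (@le_lt_trans _ _ (C * (1 - r)^-1)%:E); last by rewrite ltry.
  apply: lime_le; first exact: is_cvg_nneseries.
  apply: nearW => n; rewrite (le_trans (lee_sum _ (fun i _ => PA i)))//.
  rewrite sumEFin lee_fin.
  have := @geometric_le_lim R n C r C0 r0; rewrite ger0_norm ?(ltW r0)//.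
  by move=> /(_ r1); rewrite /series/=.
exists (lim_sup_set A); split => //.
  by apply: bigcapT_measurable => n; apply: bigcup_measurable => k _.
move=> w /= nw n _; apply: contrapT => h; apply: nw; exists n => k nk Ak.
by apply: h; exists k.
Qed.

(** The form of the moment hypothesis of Kolmogorov's criterion that chaining
    uses; it is what Markov's inequality gives from a bound on the moment of
    order a of the increments. *)
Definition tail_bound T Z C a b := forall s t lam : R, 0 <= s -> s <= T ->
  0 <= t -> t <= T -> 0 < lam ->
  (P [set w | (lam <= `|Z t w - Z s w|)%R] <= (C * `|t - s| `^ b * lam `^ (- a))%:E)%E.

Lemma measurable_increment Z (s t lam : R) :
  measurable [set w | lam <= `|Z t w - Z s w|].
Proof. by apply: measurable_abs_ge; exact: measurable_funB. Qed.

(** There are 2^n increments of level n, each exceeding 2^(- gam n) with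
    probability of order 2^(- b n + gam a n); the hypothesis gam a + 1 < b is
    exactly what makes the union bound summable. *)
Lemma dyadic_increments_ae T Z C a b gam : 0 < T -> 0 <= C -> 0 < b -> 0 < gam ->
  gam * a + 1 < b -> tail_bound T Z C a b ->
  {ae P, forall w, exists N, forall n i, (N <= n)%N -> (i < 2 ^ n)%N ->
     `|Z (dyad T n i.+1) w - Z (dyad T n i) w| <= (2 `^ (- gam)) ^+ n}.
Proof.
move=> T0 C0 b0 gam0 gab tail.
pose q : R := 2 `^ (- gam).
have q0 : 0 < q by exact: powR_gt0.
pose E n i := [set w | q ^+ n <= `|Z (dyad T n i.+1) w - Z (dyad T n i) w|].
pose A n := \big[setU/set0]_(i < 2 ^ n) E n i.
have := @borel_cantelli_geometric A (C * T `^ b) (2 `^ (1 - b + gam * a)).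
have CT : 0 <= C * T `^ b by rewrite mulr_ge0 ?powR_ge0.
have r1 : 2 `^ (1 - b + gam * a) < 1 :> R.
  by apply: powR2_lt1; lra.
move=> /(_ CT (powR_gt0 _ (ltr0Sn R 1)) r1).
have mA n : measurable (A n).
  by apply: bigsetU_measurable => i _; exact: measurable_increment.
have PA n : (P (A n) <= (C * T `^ b * (2 `^ (1 - b + gam * a)) ^+ n)%:E)%E.
  have := @Boole_inequality _ _ _ P (E n) (2 ^ n).
  move=> /(_ (fun i _ => measurable_increment _ _ _ _)) /le_trans; apply.
  apply: (@le_trans _ _ (\sum_(i < 2 ^ n)
      (C * T `^ b * 2 `^ ((- b + gam * a) * n%:R))%:E)%E).
    apply: lee_sum => i _.
    have [d0 dT] := @dyad_itv _ T n i T0 (ltnW (ltn_ord i)).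
    have [d0' dT'] := @dyad_itv _ T n i.+1 T0 (ltn_ord i).
    apply: (le_trans (tail _ _ _ d0 dT d0' dT' _)); first by rewrite exprn_gt0.
    rewrite lee_fin le_eqVlt; apply/orP; left; apply/eqP.
    have -> : `|dyad T n i.+1 - dyad T n i| = T * 2 `^ (- n%:R).
      rewrite /dyad -mulrBl -mulrBl -natrB// subSnn mul1r powR_invn//.
      by rewrite ger0_norm// divr_ge0 ?exprn_ge0// ltW.
    rewrite powRM ?powR_ge0 ?(ltW T0)// -!mulrA; congr (_ * (_ * _)).
    rewrite /q -powR_mulrn ?powR_ge0// -!powRrM -powRD ?pnatr_eq0 ?implybT//.
    by congr (_ `^ _); ring.
  rewrite sumEFin lee_fin sumr_const card_ord -[X in X <= _]mulr_natr natrX.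
  rewrite le_eqVlt; apply/orP; left; apply/eqP; rewrite -!mulrA; congr (_ * (_ * _)).
  rewrite -[in RHS]powR_mulrn ?powR_ge0// -[2 ^+ n]powR_mulrn// -powRrM.
  by rewrite -powRD ?pnatr_eq0 ?implybT//; congr (_ `^ _); ring.
move=> /(_ mA PA); apply: filterS => // w [N hN]; exists N => n i Nn i2.
have := hN n Nn; rewrite /A => nA; rewrite leNgt; apply/negP => h; apply: nA.
by rewrite -(bigcup_mkord _ (E n)); exists i => //=; exact: ltW.
Qed.

(** This identifies the limit along dyadic points with the process itself, for
    each fixed time, hence that the limit is a modification. *)
Lemma dyadic_approx_ae T Z C a b gam t : 0 < T -> 0 <= C -> 0 < b -> 0 < gam ->
  gam * a + 1 < b -> tail_bound T Z C a b -> 0 <= t -> t <= T ->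
  {ae P, forall w, Z (dyad T n (dindex T n t)) w @[n --> \oo] --> Z t w}.
Proof.
move=> T0 C0 b0 gam0 gab tail t0 tT.
pose q : R := 2 `^ (- gam).
have q0 : 0 < q by exact: powR_gt0.
have q1 : q < 1 by apply: powR2_lt1; rewrite oppr_lt0.
pose A n := [set w | q ^+ n <= `|Z t w - Z (dyad T n (dindex T n t)) w|].
have := @borel_cantelli_geometric A (C * T `^ b) (2 `^ (- b + gam * a)).
have CT : 0 <= C * T `^ b by rewrite mulr_ge0 ?powR_ge0.
have r1 : 2 `^ (- b + gam * a) < 1 :> R.
  by apply: powR2_lt1; lra.
move=> /(_ CT (powR_gt0 _ (ltr0Sn R 1)) r1).
have mA n : measurable (A n) by exact: measurable_increment.
have PA n : (P (A n) <= (C * T `^ b * (2 `^ (- b + gam * a)) ^+ n)%:E)%E.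
  have [d0 dT] := @dyad_itv _ T n _ T0 (dindex_le n T0 t0 tT).
  apply: (le_trans (tail _ _ _ d0 dT t0 tT _)); first by rewrite exprn_gt0.
  have [dt td] := dyad_dindex n T0 t0.
  rewrite lee_fin.
  apply: (@le_trans _ _ (C * (T * 2 `^ (- n%:R)) `^ b * (q ^+ n) `^ (- a))).
    rewrite ler_wpM2r ?powR_ge0// ler_wpM2l//.
    apply: ge0_ler_powR; rewrite ?nnegrE ?(ltW b0)//.
      by rewrite mulr_ge0 ?powR_ge0 ?(ltW T0).
    by rewrite powR_invn// ger0_norm ?subr_ge0.
  rewrite le_eqVlt; apply/orP; left; apply/eqP.
  rewrite powRM ?powR_ge0 ?(ltW T0)// -!mulrA; congr (_ * (_ * _)).
  rewrite /q -!powR_mulrn ?powR_ge0// -!powRrM -powRD ?pnatr_eq0 ?implybT//.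
  by congr (_ `^ _); ring.
move=> /(_ mA PA); apply: filterS => // w [N hN].
apply/cvgrPdist_lt => e e0.
have cq : q ^+ n @[n --> \oo] --> (0 : R).
  by have := @cvg_geometric _ 1 q; rewrite ger0_norm ?(ltW q0)// -exprn_geometric; exact.
near=> n; apply: (@lt_trans _ _ (q ^+ n)).
  by rewrite ltNge; apply/negP; apply: hN; near: n; exact: nbhs_infty_ge.
by near: n; exact: (cvgr_lt 0).
Unshelve. all: by end_near. Qed.

(** The modification is the upper limit of the process along dyadic
    approximations, a formula that involves neither the exponent nor an
    exceptional set: it is measurable for every outcome, and one and the same
    process serves all exponents below gam0, of which a sequence suffices. *)
Theorem kolmogorov_continuity T gam0 Z : 0 < T -> 0 < gam0 ->
  (forall gam, 0 < gam -> gam < gam0 ->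
     exists C a b, [/\ 0 <= C, 0 < b, gam * a + 1 < b & tail_bound T Z C a b]) ->
  has_hoelder_modification P T gam0 (fun t w => Z t w).
Proof.
move=> T0 g0 H.
pose z t n (w : Omega) := Z (dyad T n (dindex T n t)) w.
pose Zf t w := fine (limn_esup (fun n => (z t n w)%:E)).
have mZ t : measurable_fun setT (Zf t).
  apply: (measurableT_comp (f := fine)); first exact: fine_measurable.
  apply: measurable_fun_limn_esup => n; apply/measurable_EFinP.
  exact: measurable_funP.
pose Zt t : {RV P >-> R} := mfun_Sub (mem_set (mZ t)).
have ZtE t w l : z t n w @[n --> \oo] --> l -> Zt t w = l.
  move=> cl; rewrite /Zt/= /Zf.
  have ce : (z t n w)%:E @[n --> \oo] --> l%:E.
    by apply/fine_cvgP; split; [exact: nearW|exact: cl].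
  by have [_ ->] := cvg_limn_einf_sup ce.
exists Zt; split.
  move=> t; rewrite in_itv/= => /andP[t0 tT].
  have [C [a [b [C0 b0 gab tail]]]] := H (gam0 / 2) ltac:(lra) ltac:(lra).
  have := dyadic_approx_ae T0 C0 b0 _ gab tail t0 tT.
  move=> /(_ ltac:(lra)); apply: filterS => w.
  exact: ZtE.
(* Countably many exponents increasing to gam0 keep the exceptional set null. *)
pose gk k := gam0 * (1 - k.+2%:R^-1).
have gk0 k : 0 < gk k.
  by rewrite mulr_gt0// subr_gt0 invf_lt1// ltr1n.
have gk1 k : gk k < gam0.
  by rewrite -[ltRHS]mulr1 ltr_pM2l// gtrBl invr_gt0.
have ae k : {ae P, forall w, hoelder_on `[0, T] (gk k) (fun t => Zt t w)}.
  have [C [a [b [C0 b0 gab tail]]]] := H _ (gk0 k) (gk1 k).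
  have := dyadic_increments_ae T0 C0 b0 (gk0 k) gab tail.
  apply: filterS => w [N hN].
  have [G [cG [C' hG]]] := @dyadic_hoelder _ T (fun t => Z t w) (gk k) N T0 (gk0 k) hN.
  exists C' => s t Ds Dt.
  have E r : `[0, T]%classic r -> Zt r w = G r.
    by rewrite /= in_itv/= => /andP[r0 rT]; apply: ZtE; exact: cG.
  by rewrite !E//; exact: hG.
have := ae_foralln ae.
apply: filterS => w hw del /andP[del0 delg].
have [k hk] : exists k, del <= gk k.
  have e0 : 0 < 1 - del / gam0 by rewrite subr_gt0 ltr_pdivrMr// mul1r.
  have := real_truncnS_gt (num_real (1 - del / gam0)^-1).
  set k := Num.truncn _ => hk; exists k.
  have : k.+2%:R^-1 <= 1 - del / gam0.
    rewrite -[leRHS]invrK lef_pV2 ?posrE ?invr_gt0//.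
    by rewrite (le_trans (ltW hk))// ler_nat.
  by rewrite lerBrDl -lerBrDr ler_pdivrMr// mulrC.
exact: (hoelder_on_le (ltW T0) del0 hk (hw k)).
Qed.

End kolmogorov.

(** * Gaussian tails *)

Section gaussian_tails.
Context (R : realType).
Implicit Types (s lam v x : R).
Notation mu := (@lebesgue_measure R).

(** From exp y >= y at y = x / m, raised to the power m. *)
Lemma expR_le_powV (m : nat) x : (0 < m)%N -> 0 < x -> expR (- x) <= (m%:R / x) ^+ m.
Proof.
move=> m0 x0; have mr : 0 < m%:R :> R by rewrite ltr0n.
have -> : (m%:R / x) ^+ m = ((x / m%:R) ^+ m)^-1 by rewrite -exprVn invf_div.
rewrite expRN lef_pV2 ?posrE ?expR_gt0 ?exprn_gt0 ?divr_gt0//.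
have -> : expR x = expR (x / m%:R) ^+ m.
  by rewrite -expRM_natl -mulrCA divff ?mulr1// gt_eqF.
rewrite lerXn2r ?nnegrE ?divr_ge0 ?expR_ge0 ?(ltW x0)//.
by apply: le_trans (expR_ge1Dx _); rewrite lerDr.
Qed.

(** On |x| >= lam half of the Gaussian exponent already produces the decay, and
    the other half is a multiple of a normal density of standard deviation
    sqrt 2 s, of mass 1. *)
Lemma normal_tail s lam : 0 < s -> 0 < lam ->
  (normal_prob 0 s [set x | (lam <= `|x|)%R] <=
   (2 * expR (- (lam ^+ 2 / (4 * s ^+ 2))))%:E)%E.
Proof.
move=> s0 lam0; set A := [set x | _].
have mA : measurable A by exact: (measurable_abs_ge _ (@measurable_id _ _ setT)).
pose s2 := Num.sqrt 2 * s.
have q2 : 0 < Num.sqrt 2 :> R by rewrite sqrtr_gt0.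
have s20 : 0 < s2 by rewrite mulr_gt0.
set c := 2 * _; have c0 : 0 <= c by rewrite mulr_ge0 ?expR_ge0.
rewrite -[leRHS]mule1 -(integral_normal_pdf 0 s2) -ge0_integralZl_EFin//; last 2 first.
- by move=> x _; rewrite lee_fin normal_pdf_ge0.
- by apply: measurable_EFinTS; exact: measurable_normal_pdf.
have mc : measurable_fun setT (fun x => (c%:E * (normal_pdf 0 s2 x)%:E)%E).
  apply: measurable_funeM; apply: measurable_EFinTS; exact: measurable_normal_pdf.
apply: (@le_trans _ _ (\int[mu]_(x in A) (c%:E * (normal_pdf 0 s2 x)%:E))%E); last first.
  apply: ge0_subset_integral => // x _.
  by rewrite -EFinM lee_fin mulr_ge0// normal_pdf_ge0.
apply: ge0_le_integral => //.
- by move=> x _; rewrite lee_fin normal_pdf_ge0.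
- by apply: measurable_EFinTS; exact: measurable_normal_pdf.
- exact: measurable_funTS.
move=> x Ax; rewrite -EFinM lee_fin !normal_pdfE ?gt_eqF//.
rewrite /c /normal_peak /normal_fun !subr0.
have -> : Num.sqrt (s2 ^+ 2 * pi *+ 2) = Num.sqrt 2 * Num.sqrt (s ^+ 2 * pi *+ 2).
  rewrite -sqrtrM// /s2 exprMn sqr_sqrtr//; congr Num.sqrt.
  have gen (a b : R) : 2 * a * b *+ 2 = 2 * (a * b *+ 2) by ring.
  exact: gen.
have -> : s2 ^+ 2 = 2 * s ^+ 2 by rewrite /s2 exprMn sqr_sqrtr.
rewrite [(Num.sqrt 2 * _)^-1]invfM; set p := (Num.sqrt (s ^+ 2 * pi *+ 2))^-1.
have p0 : 0 <= p by rewrite invr_ge0 sqrtr_ge0.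
have e1 : expR (- x ^+ 2 / (s ^+ 2 *+ 2)) <=
   expR (- (lam ^+ 2 / (4 * s ^+ 2))) * expR (- x ^+ 2 / ((2 * s ^+ 2) *+ 2)).
  rewrite -expRD ler_expR.
  have xl : lam ^+ 2 <= x ^+ 2.
    rewrite -[leRHS]real_normK ?num_real// lerXn2r ?nnegrE ?(ltW lam0)//.
  have ss : 0 < s ^+ 2 by rewrite exprn_gt0.
  have -> : - x ^+ 2 / (s ^+ 2 *+ 2) = (- 2 * x ^+ 2) / (4 * s ^+ 2).
    by rewrite -mulr_natr; field; rewrite gt_eqF.
  have -> : - (lam ^+ 2 / (4 * s ^+ 2)) + - x ^+ 2 / ((2 * s ^+ 2) *+ 2) =
     (- lam ^+ 2 - x ^+ 2) / (4 * s ^+ 2).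
    by rewrite -mulr_natr; field; rewrite gt_eqF.
  by rewrite ler_pM2r ?invr_gt0 ?mulr_gt0//; lra.
(* The peaks of the two densities differ by the factor sqrt 2 <= 2. *)
have q1 : 1 <= 2 * (Num.sqrt 2)^-1 :> R.
  rewrite ler_pdivlMr// mul1r -[leRHS]ger0_norm// -sqrtr_sqr ler_wsqrtr//.
  by rewrite expr2; lra.
apply: (@le_trans _ _ (p * (expR (- (lam ^+ 2 / (4 * s ^+ 2))) *
   expR (- x ^+ 2 / ((2 * s ^+ 2) *+ 2))))).
  by rewrite ler_wpM2l.
set e := expR _; set e' := expR _.
have -> : 2 * e * ((Num.sqrt 2)^-1 * p * e') =
    (2 * (Num.sqrt 2)^-1) * (p * (e * e')) by ring.
by rewrite ler_peMl// mulr_ge0// mulr_ge0 ?expR_ge0.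
Qed.

(** A converse to concentration: since the density is at most 1 / (2 s), the
    interval of half-width s / 2 carries at most half of the mass. This is
    used to recover the parameter s from a second moment. *)
Lemma normal_center s : 0 < s ->
  (2^-1%:E <= normal_prob 0 s [set x | (s / 2 <= `|x|)%R])%E.
Proof.
move=> s0; set A := [set x | _].
have mA : measurable A by exact: (measurable_abs_ge _ (@measurable_id _ _ setT)).
have -> : normal_prob 0 s A = (1 - normal_prob 0 s (~` A))%E.
  by rewrite -[in LHS](setCK A) probability_setC//; exact: measurableC.
have : (normal_prob 0 s (~` A) <= 2^-1%:E)%E.
  have peak : normal_peak s <= (2 * s)^-1.
    have pp : 0 < s ^+ 2 * pi *+ 2.
      by rewrite pmulrn_lgt0// mulr_gt0 ?exprn_gt0 ?pi_gt0.
    rewrite /normal_peak lef_pV2 ?posrE ?mulr_gt0 ?sqrtr_gt0//.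
    rewrite -[leLHS]ger0_norm ?mulr_ge0 ?(ltW s0)// -sqrtr_sqr ler_wsqrtr//.
    have := @pi_ge2 R; have : 0 < s ^+ 2 by rewrite exprn_gt0.
    rewrite exprMn -mulr_natr; nra.
  apply: (@le_trans _ _ (\int[mu]_(x in ~` A) (cst (2 * s)^-1%:E x))%E).
    apply: ge0_le_integral => //; first exact: measurableC.
    - by move=> x _; rewrite lee_fin normal_pdf_ge0.
    - by apply: measurable_EFinTS; exact: measurable_normal_pdf.
    - by move=> x _; rewrite lee_fin (le_trans (normal_pdf_ub _ _ _)) ?gt_eqF.
  rewrite integral_cst; last exact: measurableC.
  have -> : ~` A = `](- (s / 2)), (s / 2)[%classic.
    by apply/seteqP; split => x; rewrite /A/= in_itv/= -ltr_norml ltNge => /negP.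
  rewrite /= lebesgue_measure_itv/= lte_fin ifT; last by lra.
  rewrite -EFinB -EFinM lee_fin le_eqVlt; apply/orP; left; apply/eqP.
  by field; rewrite gt_eqF.
rewrite leeBrDr; last first.
  by rewrite fin_num_measure//; exact: measurableC.
move=> h; apply: (le_trans (leeD2l _ h)).
by rewrite -EFinD lee_fin; lra.
Qed.

Context (d : measure_display) (Omega : measurableType d) (P : probability Omega R).

Lemma second_moment_tail (G : Omega -> R) lam : measurable_fun setT G -> 0 < lam ->
  ((lam ^+ 2)%:E * P [set w | (lam <= `|G w|)%R] <= \int[P]_w (G w ^+ 2)%:E)%E.
Proof.
move=> mG lam0; set A := [set w | _].
have mA : measurable A by exact: measurable_abs_ge.
rewrite -[A]setIT -integral_indic// -ge0_integralZl_EFin//; last 2 first.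
- by apply: measurable_EFinTS; exact: measurable_indic.
- by rewrite exprn_ge0// ltW.
apply: ge0_le_integral => //.
- by move=> w _; rewrite -EFinM lee_fin mulr_ge0// exprn_ge0// ltW.
- by apply: measurable_funeM; apply: measurable_EFinTS; exact: measurable_indic.
- by apply: measurable_EFinTS; exact: measurable_funX.
move=> w _; rewrite -EFinM lee_fin indicE.
have [wA|wA] := boolP (w \in A); last by rewrite mulr0 sqr_ge0.
rewrite mulr1 -[leRHS]real_normK ?num_real// lerXn2r ?nnegrE ?(ltW lam0)//.
by move: wA; rewrite inE.
Qed.

(** The parameter s of the law is not given, only a bound v on the second
    moment; [normal_center] and Chebyshev's inequality at level s / 2 give
    s^2 <= 8 v. *)
Lemma gaussian_tail (G : Omega -> R) v lam (m : nat) : (0 < m)%N ->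
  measurable_fun setT G -> centered_gaussian P G -> 0 < v -> 0 < lam ->
  (\int[P]_w (G w ^+ 2)%:E <= v%:E)%E ->
  (P [set w | (lam <= `|G w|)%R] <= (2 * (32 * m%:R * v / lam ^+ 2) ^+ m)%:E)%E.
Proof.
move=> m0 mG [s s0 hG] v0 lam0 Gv.
have b0 : 0 <= 2 * (32 * m%:R * v / lam ^+ 2) ^+ m.
  by rewrite mulr_ge0// exprn_ge0// divr_ge0 ?mulr_ge0 ?exprn_ge0// ltW.
have mA (l : R) : measurable [set x : R | l <= `|x|].
  exact: (measurable_abs_ge _ (@measurable_id _ _ setT)).
have law (l : R) : P [set w | l <= `|G w|] =
    if s == 0 then \d_(0 : R) [set x : R | l <= `|x|]
    else normal_prob 0 s [set x | l <= `|x|].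
  by rewrite -(hG _ (mA l)).
have [sz|sn0] := eqVneq s 0.
  rewrite law sz eqxx diracE memNset ?lee_fin//=.
  by rewrite normr0; apply/negP; rewrite -ltNge.
have sp : 0 < s by rewrite lt_neqAle eq_sym sn0.
have sv : s ^+ 2 <= 8 * v.
  have := second_moment_tail mG (divr_gt0 sp (ltr0Sn R 1)).
  move=> /le_trans /(_ Gv); rewrite law (negbTE sn0) => h.
  have : (((s / 2) ^+ 2 * 2^-1)%:E <= v%:E)%E.
    apply: le_trans h; rewrite EFinM; apply: lee_wpmul2l; last exact: normal_center.
    by rewrite lee_fin sqr_ge0.
  by rewrite lee_fin; nra.
rewrite law (negbTE sn0) (le_trans (normal_tail sp lam0))// lee_fin ler_pM2l//.
have ss : 0 < s ^+ 2 by rewrite exprn_gt0.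
have ll : 0 < lam ^+ 2 by rewrite exprn_gt0.
apply: (le_trans (expR_le_powV m0 _)); first by rewrite divr_gt0 ?mulr_gt0.
rewrite lerXn2r ?nnegrE ?divr_ge0 ?mulr_ge0 ?(ltW ll) ?(ltW ss) ?(ltW v0) ?(ltW lam0)//.
rewrite invf_div mulrA ler_pM2r ?invr_gt0//.
have : 0 < m%:R :> R by rewrite ltr0n.
by nra.
Qed.

End gaussian_tails.

(** * Increments of Wiener integrals *)

Section second_moments.
Context (R : realType) (d : measure_display) (T : measurableType d).
Variable mu : {measure set T -> \bar R}.

Lemma integral_sqr_lincomb (I : Type) (c : I -> R) (f : I -> T -> R) (l : seq I) :
  (forall i j, mu.-integrable setT (fun z => (f i z * f j z)%:E)) ->
  (\int[mu]_z ((\sum_(i <- l) c i * f i z) ^+ 2)%:E =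
   \sum_(i <- l) \sum_(j <- l) (c i * c j)%:E * \int[mu]_z (f i z * f j z)%:E)%E.
Proof.
move=> fi.
have ii i j : mu.-integrable setT (fun z => ((c i * c j)%:E * (f i z * f j z)%:E)%E).
  exact: integrableZl.
transitivity (\int[mu]_z (\sum_(i <- l)
    \sum_(j <- l) (c i * c j)%:E * (f i z * f j z)%:E))%E.
  apply: eq_integral => z _.
  rewrite expr2 mulr_suml -sumEFin; apply: eq_bigr => i _.
  rewrite mulr_sumr -sumEFin; apply: eq_bigr => j _.
  by rewrite -EFinM; congr EFin; ring.
rewrite integral_sum//; last by move=> i; apply: integrable_sum.
apply: eq_bigr => i _; rewrite integral_sum//; apply: eq_bigr => j _.
by rewrite integralZl.
Qed.

Lemma integrable_mul_sqr (f g : T -> R) : measurable_fun setT f -> measurable_fun setT g ->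
  (\int[mu]_z (f z * f z)%:E < +oo)%E -> (\int[mu]_z (g z * g z)%:E < +oo)%E ->
  mu.-integrable setT (fun z => (f z * g z)%:E).
Proof.
move=> mf mg fo go.
have sq (h : T -> R) : measurable_fun setT h -> (\int[mu]_z (h z * h z)%:E < +oo)%E ->
    mu.-integrable setT (fun z => (h z * h z)%:E).
  move=> mh ho; apply/integrableP; split.
    by apply: measurable_EFinTS; exact: measurable_funM.
  under eq_integral do rewrite gee0_abs ?lee_fin -?expr2 ?sqr_ge0//.
  by under eq_integral do rewrite expr2.
apply: (le_integrable _ _ _ (integrableD measurableT (sq _ mf fo) (sq _ mg go))) => //.
  by apply: measurable_EFinTS; exact: measurable_funM.
move=> z _; rewrite -EFinD !abse_EFin lee_fin.
rewrite [leRHS]ger0_norm -?expr2 ?addr_ge0 ?sqr_ge0// ler_norml.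
have := sqr_ge0 (f z + g z); have := sqr_ge0 (f z - g z).
have := sqr_ge0 (f z); have := sqr_ge0 (g z).
by move: (f z) (g z) => a b *; apply/andP; split; nra.
Qed.

(** The triangle inequality in L2, in a form that also holds when the integrals
    are infinite. *)
Lemma integral_sqrB_le (f g : T -> R) : measurable_fun setT f -> measurable_fun setT g ->
  (\int[mu]_z ((f z - g z) ^+ 2)%:E <=
     2%:E * \int[mu]_z (f z ^+ 2)%:E + 2%:E * \int[mu]_z (g z ^+ 2)%:E)%E.
Proof.
move=> mf mg.
have mf2 : measurable_fun setT (fun z => (f z ^+ 2)%:E).
  by apply: measurable_EFinTS; exact: measurable_funX.
have mg2 : measurable_fun setT (fun z => (g z ^+ 2)%:E).
  by apply: measurable_EFinTS; exact: measurable_funX.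
have p2 (r : R) : (0 <= (r ^+ 2)%:E)%E by rewrite lee_fin sqr_ge0.
rewrite -!ge0_integralZl_EFin// -ge0_integralD//; last 4 first.
- by move=> z _; rewrite mule_ge0.
- exact: measurable_funeM.
- by move=> z _; rewrite mule_ge0.
- exact: measurable_funeM.
apply: ge0_le_integral => //.
- by apply: measurable_EFinTS; apply: measurable_funX; exact: measurable_funB.
- by apply: emeasurable_funD; exact: measurable_funeM.
move=> z _; rewrite -!EFinM -EFinD lee_fin.
by have := sqr_ge0 (f z + g z); move: (f z) (g z) => a b; nra.
Qed.

Lemma integral_indic_sqr (D : set T) (f : T -> R) :
  (\int[mu]_z ((\1_D z * f z) ^+ 2)%:E = \int[mu]_(z in D) (f z ^+ 2)%:E)%E.
Proof.
rewrite [RHS]integral_mkcond; apply: eq_integral => z _; rewrite /patch indicE.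
by case: ifPn => _; rewrite ?mul1r// mul0r expr0n.
Qed.

End second_moments.

Section wiener.
Context (R : realType) (d : measure_display) (Omega : measurableType d)
        (P : probability Omega R) (T : R) (W : set (R * R) -> {RV P >-> R}).
Hypothesis hW : white_noise T W.

(** The sets on which the white noise is specified. Indexing combinations by
    lists over this type keeps the side conditions out of the statements and
    lets simple integrals over different domains be concatenated. *)
Definition noise_set : Type :=
  {A : set (R * R) | measurable A /\ A `<=` cylinder T}.

Definition noise_comb (l : seq (R * noise_set)) (w : Omega) : R :=
  \sum_(p <- l) p.1 * W (sval p.2) w.

Definition step_comb (l : seq (R * noise_set)) (z : R * R) : R :=
  \sum_(p <- l) p.1 * \1_(sval p.2) z.

Lemma noise_comb_gaussian l : centered_gaussian P (noise_comb l).
Proof.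
have [h _] := hW.
have := h (size l) (fun i => sval (tnth (in_tuple l) i).2)
  (fun i => (tnth (in_tuple l) i).1).
have -> : noise_comb l = (fun w => \sum_(i < size l) (tnth (in_tuple l) i).1 *
   W (sval (tnth (in_tuple l) i).2) w).
  by apply/funext => w; rewrite /noise_comb big_tnth.
by apply => i; exact: (svalP (tnth (in_tuple l) i).2).
Qed.

Lemma measurable_noise_comb l : measurable_fun setT (noise_comb l).
Proof.
apply: measurable_sum => p; apply: measurable_funM => //.
Qed.

(** Ito's isometry for step functions: expanding both squares, the covariances
    of the noise are the measures of the intersections. *)
Lemma noise_comb_isometry l :
  (\int[P]_w (noise_comb l w ^+ 2)%:E = \int[leb2 R]_z (step_comb l z ^+ 2)%:E)%E.
Proof.
have [_ h] := hW.
have hE (a b : noise_set) : (\int[P]_w (W (sval a) w * W (sval b) w)%:E =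
    leb2 R (sval a `&` sval b))%E.
  have [[ma ca] [mb cb]] := (svalP a, svalP b).
  by have := h _ _ ma ca mb cb; rewrite expectation.unlock.
have hL (a b : noise_set) : (\int[leb2 R]_z (\1_(sval a) z * \1_(sval b) z)%:E =
    leb2 R (sval a `&` sval b))%E.
  have [[ma ca] [mb cb]] := (svalP a, svalP b).
  transitivity (\int[leb2 R]_z (\1_(sval a `&` sval b) z)%:E)%E.
    by apply: eq_integral => z _; rewrite indicI.
  by rewrite integral_indic ?setIT//; exact: measurableI.
have fin (a b : noise_set) : (leb2 R (sval a `&` sval b) < +oo)%E.
  have [[ma ca] [mb cb]] := (svalP a, svalP b).
  apply: (le_lt_trans _ (cylinder_finite T)); apply: le_measure; rewrite ?inE.
  - exact: measurableI.
  - exact: measurable_cylinder.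
  - by move=> z [/ca].
have EW := @integral_sqr_lincomb R _ _ P _ (fun p : R * noise_set => p.1)
  (fun p w => W (sval p.2) w) l.
have EL := @integral_sqr_lincomb R _ _ (leb2 R) _ (fun p : R * noise_set => p.1)
  (fun p z => \1_(sval p.2) z) l.
etransitivity; [apply: EW => p q|etransitivity; [|apply/esym; apply: EL => p q]].
- by apply: integrable_mul_sqr; rewrite ?hE ?fin.
- by apply: eq_bigr => p _; apply: eq_bigr => q _; rewrite hE hL.
- have [[ma ca] [mb cb]] := (svalP p.2, svalP q.2).
  by apply: integrable_mul_sqr; rewrite ?hL ?fin//; exact: measurable_indic.
Qed.

Definition slice (D : set (R * R)) (mD : measurable D /\ D `<=` cylinder T)
    (h : {sfun (R * R)%type >-> R}) (c : R) : noise_set.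
exists (D `&` h @^-1` [set c]); split.
  by apply: measurableI; [exact: mD.1|exact: measurable_sfunP].
by move=> z [/mD.2].
Defined.

(** The step function e h on D, written as a combination of indicators of its
    level sets; the sign e serves to form differences. *)
Definition slices (e : R) (D : set (R * R)) mD (h : {sfun (R * R)%type >-> R}) :
    seq (R * noise_set) :=
  [seq (e * c, @slice D mD h c) | c <- finmap.enum_fset (fset_set (range h))].

Lemma noise_comb_slices e D mD h w :
  noise_comb (@slices e D mD h) w = e * wiener_sintegral W D h w.
Proof.
rewrite /noise_comb /slices big_map /wiener_sintegral fsbig_finite//=.
by rewrite mulr_sumr; apply: eq_bigr => c _; rewrite mulrA.
Qed.

Lemma step_comb_slices e D mD (h : {sfun (R * R)%type >-> R}) z :
  step_comb (@slices e D mD h) z = e * (\1_D z * h z).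
Proof.
rewrite /step_comb /slices big_map /= [in RHS](fimfunE h) fsbig_finite//=.
rewrite !mulr_sumr; apply: eq_bigr => c _; rewrite indicI -mulrA /=.
by congr (_ * _); rewrite mulrCA.
Qed.

Lemma measurable_wiener_sintegral D h : measurable_fun setT (wiener_sintegral W D h).
Proof.
rewrite (_ : wiener_sintegral W D h = fun w =>
  \sum_(c <- finmap.enum_fset (fset_set (range h))) c * W (D `&` h @^-1` [set c]) w).
  by apply: measurable_sum => c; exact: measurable_funM.
by apply/funext => w; rewrite /wiener_sintegral fsbig_finite.
Qed.

(** 2 (512 m)^m + 1, with 512 = 32 * 4 * 2^2: 32 from [gaussian_tail], 4 because
    the approximating variances are bounded by 4 V, and 2^2 because the level is
    halved. *)
Definition increment_const (m : nat) : R := 2 * (m%:R * (32 * (4 * (2 * 2)))) ^+ m + 1.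

Lemma increment_const_ge0 m : 0 <= increment_const m.
Proof. by rewrite addr_ge0// mulr_ge0// exprn_ge0// !mulr_ge0. Qed.

(** The difference I1 - I2 is not known to be Gaussian, only to be an L2 limit of
    Gaussian combinations. Stopping at an approximation so good that its error
    exceeds lam / 2 with probability at most (V / lam^2)^m avoids any discussion
    of limits of Gaussian laws; the error is chosen after lam and m. *)
Lemma wiener_increment_tail (D1 D2 : set (R * R)) (g1 g2 : R * R -> R)
    (I1 I2 : {RV P >-> R}) (V lam : R) (m : nat) :
  measurable D1 -> D1 `<=` cylinder T -> measurable D2 -> D2 `<=` cylinder T ->
  measurable_fun setT g1 -> measurable_fun setT g2 ->
  is_wiener_integral W D1 g1 I1 -> is_wiener_integral W D2 g2 I2 ->
  (\int[leb2 R]_z ((\1_D1 z * g1 z - \1_D2 z * g2 z) ^+ 2)%:E <= V%:E)%E ->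
  0 < V -> 0 < lam -> (0 < m)%N ->
  (P [set w | (lam <= `|I1 w - I2 w|)%R] <=
   (increment_const m * (V / lam ^+ 2) ^+ m)%:E)%E.
Proof.
move=> mD1 D1T mD2 D2T mg1 mg2 [h1 [c1 e1]] [h2 [c2 e2]] gV V0 lam0 m0.
have -> : increment_const m * (V / lam ^+ 2) ^+ m =
    2 * (32 * m%:R * (4 * V) / (lam / 2) ^+ 2) ^+ m + (V / lam ^+ 2) ^+ m.
  rewrite /increment_const mulrDl mul1r -mulrA -exprMn; congr (2 * _ ^+ m + _).
  by field; rewrite gt_eqF.
pose l n := slices 1 (conj mD1 D1T) (h1 n) ++ slices (-1) (conj mD2 D2T) (h2 n).
pose G n := noise_comb (l n).
have GE n w : G n w = wiener_sintegral W D1 (h1 n) w - wiener_sintegral W D2 (h2 n) w.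
  by rewrite /G /noise_comb big_cat/= -!/(noise_comb _ _) !noise_comb_slices mul1r mulN1r.
have SE n z : step_comb (l n) z = \1_D1 z * h1 n z - \1_D2 z * h2 n z.
  by rewrite /step_comb big_cat/= -!/(step_comb _ _) !step_comb_slices mul1r mulN1r.
pose e := (V / lam ^+ 2) ^+ m.
have l20 : 0 < lam ^+ 2 by rewrite exprn_gt0.
have e0 : 0 < e by rewrite exprn_gt0// divr_gt0.
(* V / 8 keeps the variance of the approximation below 4 V; the second bound
   makes Chebyshev's estimate 4 del / (lam / 2)^2 of the error at most e. *)
pose del := Num.min (V / 8) (e * lam ^+ 2 / 16).
have del0 : 0 < del by rewrite /del lt_min !divr_gt0// mulr_gt0.
have ev (u : (\bar R)^nat) : (u @ \oo --> 0)%E -> \forall n \near \oo, (u n <= del%:E)%E.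
  move=> /fine_cvgP[fu /cvgrPdist_le/(_ _ del0)]; apply: filterS2 fu => n fu.
  by rewrite sub0r normrN -(fineK fu) lee_fin => /(le_trans (ler_norm _)).
have [N [a1 a2 b1 b2]] : exists n,
  [/\ (\int[leb2 R]_(z in D1) ((h1 n z - g1 z) ^+ 2)%:E <= del%:E)%E,
      (\int[leb2 R]_(z in D2) ((h2 n z - g2 z) ^+ 2)%:E <= del%:E)%E,
      (\int[P]_w ((wiener_sintegral W D1 (h1 n) w - I1 w) ^+ 2)%:E <= del%:E)%E &
      (\int[P]_w ((wiener_sintegral W D2 (h2 n) w - I2 w) ^+ 2)%:E <= del%:E)%E].
  rewrite expectation.unlock in e1 e2.
  by near \oo => n; exists n; split; near: n; exact: ev.
have mh (h : {sfun (R * R)%type >-> R}) : measurable_fun setT h by exact: measurable_funP.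
have dV : del <= V / 8 by rewrite /del ge_min lexx.
have de : del <= e * lam ^+ 2 / 16 by rewrite /del ge_min lexx orbT.
have bound2 (x y : \bar R) : (x <= del%:E -> y <= del%:E ->
    2%:E * x + 2%:E * y <= (4 * del)%:E)%E.
  move=> xd yd; have -> : (4 * del)%:E = (2%:E * del%:E + 2%:E * del%:E)%E.
    by rewrite -!EFinM -EFinD; congr EFin; ring.
  by apply: leeD; apply: lee_wpmul2l.
have GV : (\int[P]_w (G N w ^+ 2)%:E <= (4 * V)%:E)%E.
  rewrite /G noise_comb_isometry.
  pose A z := \1_D1 z * (h1 N z - g1 z) - \1_D2 z * (h2 N z - g2 z).
  pose B z := \1_D2 z * g2 z - \1_D1 z * g1 z.
  have m1 : measurable_fun setT (fun z => \1_D1 z * (h1 N z - g1 z)).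
    by apply: measurable_funM; [exact: measurable_indic|exact: measurable_funB].
  have m2 : measurable_fun setT (fun z => \1_D2 z * (h2 N z - g2 z)).
    by apply: measurable_funM; [exact: measurable_indic|exact: measurable_funB].
  have mA : measurable_fun setT A by exact: measurable_funB.
  have mB : measurable_fun setT B.
    by apply: measurable_funB; apply: measurable_funM => //; exact: measurable_indic.
  have -> : (\int[leb2 R]_z (step_comb (l N) z ^+ 2)%:E =
      \int[leb2 R]_z ((A z - B z) ^+ 2)%:E)%E.
    by apply: eq_integral => z _; rewrite SE; congr (_ ^+ 2)%:E; rewrite /A /B; ring.
  have AB := integral_sqrB_le (leb2 R) mA mB; apply: (le_trans AB).
  have hB : (\int[leb2 R]_z (B z ^+ 2)%:E <= V%:E)%E.
    by under eq_integral do rewrite /B -sqrrN opprB.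
  have hA : (\int[leb2 R]_z (A z ^+ 2)%:E <= (4 * del)%:E)%E.
    have A12 := integral_sqrB_le (leb2 R) m1 m2; apply: (le_trans A12).
    by rewrite !integral_indic_sqr; exact: bound2.
  apply: (@le_trans _ _ (2%:E * (4 * del)%:E + 2%:E * V%:E)%E).
    by apply: leeD; apply: lee_wpmul2l.
  by rewrite -!EFinM -EFinD lee_fin; lra.
have mG : measurable_fun setT (G N) by exact: measurable_noise_comb.
have gG : centered_gaussian P (G N) by exact: noise_comb_gaussian.
pose F w := (wiener_sintegral W D1 (h1 N) w - I1 w) -
  (wiener_sintegral W D2 (h2 N) w - I2 w).
have mF1 : measurable_fun setT (fun w => wiener_sintegral W D1 (h1 N) w - I1 w).
  by apply: measurable_funB => //; exact: measurable_wiener_sintegral.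
have mF2 : measurable_fun setT (fun w => wiener_sintegral W D2 (h2 N) w - I2 w).
  by apply: measurable_funB => //; exact: measurable_wiener_sintegral.
have mF : measurable_fun setT F by exact: measurable_funB.
have lam20 : 0 < lam / 2 by rewrite divr_gt0.
apply: (@le_trans _ _ (P ([set w | (lam / 2 <= `|G N w|)%R] `|`
    [set w | (lam / 2 <= `|F w|)%R]))).
  apply: le_measure; rewrite ?inE.
  - by apply: measurable_abs_ge; exact: measurable_funB.
  - by apply: measurableU; exact: measurable_abs_ge.
  move=> w /= lw; have [Gw|Gw] := leP (lam / 2) `|G N w|; first by left.
  right => /=; rewrite leNgt; apply/negP => Fw.
  move: lw; rewrite leNgt => /negP; apply.
  have -> : I1 w - I2 w = G N w - F w by rewrite GE /F; ring.
  by apply: (le_lt_trans (ler_normB _ _)); lra.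
apply: (le_trans (measureU2 _ _ _)); [exact: measurable_abs_ge..|].
rewrite EFinD; apply: leeD.
  by apply: gaussian_tail => //; rewrite mulr_gt0.
have sm := second_moment_tail P mF lam20.
have FE : (\int[P]_w (F w ^+ 2)%:E <= (4 * del)%:E)%E.
  by apply: (le_trans (integral_sqrB_le _ mF1 mF2)); exact: bound2.
have := le_trans sm FE.
rewrite -lee_pdivlMl ?exprn_gt0// => /le_trans; apply.
rewrite -EFinM lee_fin -/e mulrC ler_pdivrMr ?exprn_gt0// expr_div_n.
have -> : e * (lam ^+ 2 / 2 ^+ 2) = 4 * (e * lam ^+ 2 / 16) by field.
by rewrite ler_pM2l.
Unshelve. all: by end_near. Qed.

End wiener.

(** * Tonelli on the plane *)

Section sigma_finite_plane.
Variable R : realType.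
(** A name for Lebesgue measure on the plane that carries its sigma-finiteness,
    the hypothesis under which Tonelli's theorem applies to the product of the
    plane and the probability space. *)
Definition plane_measure : set (measurableTypeR R * measurableTypeR R)%type -> \bar R :=
  leb2 R.

Lemma plane_measure0 : plane_measure set0 = 0%E.
Proof. exact: (measure0 (leb2 R)). Qed.

Lemma plane_measure_ge0 A : (0 <= plane_measure A)%E.
Proof. exact: (measure_ge0 (leb2 R)). Qed.

Lemma plane_measure_sa : semi_sigma_additive plane_measure.
Proof. exact: (@measure_semi_sigma_additive _ _ _ (leb2 R)). Qed.
HB.instance Definition _ := isMeasure.Build _ _ _
  plane_measure plane_measure0 plane_measure_ge0 plane_measure_sa.
Lemma plane_measure_sf : sigma_finite setT plane_measure.
Proof.
pose F n : set R := `[- n%:R, n%:R]%classic.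
exists (fun n => F n `*` F n).
  apply/esym; rewrite -subTset => -[x y] _.
  exists (maxn (Num.truncn `|x|).+1 (Num.truncn `|y|).+1) => //.
  split; rewrite /F/= in_itv/= -ler_norml.
    by rewrite (le_trans (ltW (real_truncnS_gt (normr_real x))))// ler_nat leq_maxl.
  by rewrite (le_trans (ltW (real_truncnS_gt (normr_real y))))// ler_nat leq_maxr.
move=> n; split; first by apply: measurableX; exact: measurable_itv.
rewrite /plane_measure product_measure1E; [|exact: measurable_itv..].
rewrite /= !lebesgue_measure_itv/=; case: ifPn => _; last by rewrite mule0 ltry.
by rewrite -EFinB -EFinM ltry.
Qed.
HB.instance Definition _ := Measure_isSigmaFinite.Build _ _ _
  plane_measure plane_measure_sf.
Lemma plane_measure_integral (D : set (R * R)) (f : R * R -> \bar R) :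
  (\int[plane_measure]_(z in D) f z = \int[leb2 R]_(z in D) f z)%E.
Proof. by apply: eq_measure_integral. Qed.

Context (d : measure_display) (Omega : measurableType d) (P : probability Omega R).

Lemma measurable_integral_leb2 (G : (R * R) * Omega -> \bar R) :
  measurable_fun setT G -> (forall p, 0 <= G p)%E ->
  measurable_fun setT (fun w => \int[leb2 R]_z G (z, w))%E.
Proof.
move=> mG G0; under eq_fun do rewrite -plane_measure_integral.
exact: (measurable_fun_fubini_tonelli_G (m1 := plane_measure) G mG G0).
Qed.

Lemma tonelli_leb2 (G : (R * R) * Omega -> \bar R) :
  measurable_fun setT G -> (forall p, 0 <= G p)%E ->
  (\int[leb2 R]_z \int[P]_w G (z, w) = \int[P]_w \int[leb2 R]_z G (z, w))%E.
Proof.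
move=> mG G0; rewrite -plane_measure_integral.
under [RHS]eq_integral do rewrite -plane_measure_integral.
exact: (fubini_tonelli (m1 := plane_measure) (m2 := P) G mG G0).
Qed.

End sigma_finite_plane.

(** * Hoelder continuity of the drift *)

Lemma normr_Rintegral_le (R : realType) (D : set (R * R)) (f : R * R -> R) (c : R) :
  measurable D -> (leb2 R).-integrable D (EFin \o f) ->
  (\int[leb2 R]_(z in D) `|f z|%:E <= c%:E)%E -> `|\int[leb2 R]_(z in D) f z| <= c.
Proof.
move=> mD fi fc; rewrite -lee_fin EFin_normr_Rintegral//.
apply: le_trans fc; have /integrableP[mf _] := fi.
exact: (le_abse_integral (leb2 R) mD mf).
Qed.

Lemma exprD_le_double (R : realType) (a b : R) n : 0 <= a -> 0 <= b ->
  (a + b) ^+ n <= (2 * a) ^+ n + (2 * b) ^+ n.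
Proof.
move=> a0 b0; have [ab|ba] := leP a b.
  apply: (@le_trans _ _ ((2 * b) ^+ n)); last by rewrite lerDr exprn_ge0// mulr_ge0.
  by rewrite lerXn2r ?nnegrE ?addr_ge0 ?mulr_ge0//; lra.
apply: (@le_trans _ _ ((2 * a) ^+ n)); last by rewrite lerDl exprn_ge0// mulr_ge0.
by rewrite lerXn2r ?nnegrE ?addr_ge0 ?mulr_ge0//; lra.
Qed.

Lemma expr14_ge0 (R : realType) (r : R) : 0 <= r ^+ 14.
Proof. by rewrite (exprM _ 2 7) exprn_ge0// sqr_ge0. Qed.

Lemma reaction_pow14 (R : realType) (v : R) :
  reaction v ^+ 14 <= (2 * 2) ^+ 7 + (2 * 8) ^+ 7 * `|v| ^+ 42.
Proof.
have h : reaction v ^+ 2 <= 2 + 8 * `|v| ^+ 6.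
  have -> : `|v| ^+ 6 = v ^+ 6 by rewrite (exprM _ 2 3) real_normK ?num_real// -exprM.
  have := sqr_ge0 v; have -> : v ^+ 6 = (v ^+ 2) ^+ 3 by rewrite -exprM.
  have -> : reaction v ^+ 2 = v ^+ 2 * (1 - v ^+ 2) ^+ 2 by rewrite /reaction; ring.
  by move: (v ^+ 2) => a; have [|] := lerP a 1; nra.
rewrite (exprM _ 2 7) (exprM _ 6 7) -exprMn -mulrA.
apply: (@le_trans _ _ ((2 + 8 * `|v| ^+ 6) ^+ 7)).
  by rewrite lerXn2r ?nnegrE ?sqr_ge0 ?addr_ge0 ?mulr_ge0 ?exprn_ge0.
by apply: exprD_le_double; rewrite ?mulr_ge0 ?exprn_ge0.
Qed.

(** Young's inequality in two steps: |f| <= A + A^-6 |f|^7, as one sees by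
    comparing |f| with A, and 2 |k| |f|^7 <= k^2 + f^14. The high power of f
    is harmless, since all moments are finite, and costs only a small power of
    A on the first term. *)
Lemma normrM_young (R : realType) (A k f : R) : 0 < A ->
  `|k * f| <= A * `|k| + A ^- 6 * (k ^+ 2 + f ^+ 14).
Proof.
move=> A0; have A6 : 0 < A ^+ 6 by rewrite exprn_gt0.
rewrite normrM -[k ^+ 2]real_normK ?num_real//.
have -> : f ^+ 14 = (`|f| ^+ 7) ^+ 2.
  by rewrite (exprM _ 2 7) -[f ^+ 2]real_normK ?num_real// -!exprM.
have : 0 <= `|k| by []. have : 0 <= `|f| by [].
move: `|k| `|f| => a b b0 a0.
have h : b <= A + A ^- 6 * b ^+ 7.
  have [bA|Ab] := leP b A.
    by rewrite ler_wpDr// mulr_ge0 ?exprn_ge0 ?invr_ge0 ?(ltW A6).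
  rewrite ler_wpDl ?(ltW A0)// mulrC ler_pdivlMr// [b ^+ 7]exprS ler_wpM2l//.
  by rewrite lerXn2r ?nnegrE ?(ltW A0) ?(ltW Ab).
apply: (le_trans (ler_wpM2l a0 h)); rewrite mulrDr [a * A]mulrC lerD2l mulrCA.
rewrite ler_wpM2l ?invr_ge0 ?(ltW A6)//.
by move: (b ^+ 7) => c; have := sqr_ge0 (a - c); have := sqr_ge0 (a + c); nra.
Qed.

Section drift.
Context (R : realType) (d : measure_display) (Omega : measurableType d)
        (P : probability Omega R) (T : R).
Hypothesis T0 : 0 < T.
Variable u : R -> R -> Omega -> R.
Hypothesis mu_ : measurable_fun (cylinder T `*` [set: Omega])
  (fun z : (R * R) * Omega => u z.1.1 z.1.2 z.2).
Hypothesis hmom : bounded_moments P T u.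

(** The reaction term, set to 0 off the cylinder so that it is measurable on the
    whole plane. *)
Definition force (w : Omega) (z : R * R) : R :=
  \1_(cylinder T) z * reaction (u z.1 z.2 w).

Lemma measurable_cylinder_setT : measurable (cylinder T `*` [set: Omega]).
Proof. by apply: measurableX => //; exact: measurable_cylinder. Qed.

Lemma measurable_force : measurable_fun setT (fun p : (R * R) * Omega => force p.2 p.1).
Proof.
have mc := measurable_cylinder_setT.
pose v := (fun z : (R * R) * Omega => reaction (u z.1.1 z.1.2 z.2)) \_
  (cylinder T `*` [set: Omega]).
have -> : (fun p : (R * R) * Omega => force p.2 p.1) = v.
  apply/funext => -[z w]; rewrite /force /v/= /patch indicE.
  have -> : ((z, w) \in cylinder T `*` [set: Omega]) = (z \in cylinder T).
    by apply/idP/idP; rewrite !inE/= => // -[].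
  by case: ifP; rewrite ?mul1r ?mul0r.
apply/(measurable_restrictT _ _).1 => //.
rewrite /reaction; apply: measurable_funB => //.
exact: measurable_funX.
Qed.

Lemma measurable_force_slice w : measurable_fun setT (force w).
Proof.
exact: (measurableT_comp (f := fun p : (R * R) * Omega => force p.2 p.1)
  measurable_force (g := fun z : R * R => (z, w))).
Qed.

Lemma drift_force t x w : t <= T ->
  drift u t x w = \int[leb2 R]_(z in cylinder T) (hker t x z * force w z).
Proof.
move=> tT; rewrite /drift /Rintegral; congr fine.
rewrite integral_mkcond [RHS]integral_mkcond; apply: eq_integral => z _.
rewrite /patch /drift_integrand /force indicE -/(hker t x z).
have := cylinder_hker x z tT; rewrite !indicE.
case: (z \in cylinder t); case: (z \in cylinder T); rewrite ?mul1r ?mul0r //.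
- by move=> ->; rewrite mul0r.
- by move=> <-; rewrite mul0r.
Qed.

Lemma measurable_slice_u z : cylinder T z -> measurable_fun setT (fun w => u z.1 z.2 w).
Proof.
move=> cz; have -> : (fun w => u z.1 z.2 w) =
  (fun p : (R * R) * Omega => u p.1.1 p.1.2 p.2) \o (fun w => (z, w)) by [].
apply: (measurable_comp measurable_cylinder_setT _ mu_).
- by move=> _ [w _ <-].
- exact: measurable_fun_pair.
Qed.

(** The 14th power of the force is at most a constant plus a multiple of
    |u|^42, whose expectation is bounded uniformly on the cylinder; by Tonelli's
    theorem the space-time integral has finite expectation, hence is finite
    almost surely. *)
Lemma force_moment_ae :
  {ae P, forall w, (\int[leb2 R]_(z in cylinder T) (force w z ^+ 14)%:E < +oo)%E}.
Proof.
pose G (p : (R * R) * Omega) := (force p.2 p.1 ^+ 14)%:E.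
have mG : measurable_fun setT G.
  by apply: measurable_EFinTS; apply: measurable_funX; exact: measurable_force.
have ev (r : R) : (0 <= (r ^+ 14)%:E)%E by rewrite lee_fin expr14_ge0.
have G0 p : (0 <= G p)%E by exact: ev.
pose J w := (\int[leb2 R]_z G (z, w))%E.
have mJ : measurable_fun setT J by exact: measurable_integral_leb2.
have J0 w : (0 <= J w)%E by exact: integral_ge0.
have [M M0 hM] : exists2 M : R, 0 <= M & forall z, cylinder T z ->
    (\int[P]_w (`|u z.1 z.2 w| ^+ 42)%:E <= M%:E)%E.
  have := hmom (_ : 2 <= 42%:R); rewrite ler_nat => /(_ isT).
  set S := ereal_sup _ => Soo.
  have hS z : cylinder T z -> (\int[P]_w (`|u z.1 z.2 w| ^+ 42)%:E <= S)%E.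
    move=> cz; apply: ereal_sup_ubound; exists z => //.
    rewrite expectation.unlock; apply: eq_integral => w _.
    by rewrite powR_mulrn.
  have S0 : (0 <= S)%E.
    have c0 : cylinder T (0, 0) by
      rewrite /cylinder /torus /= !in_itv/= lexx ltr01 (ltW T0).
    by apply: le_trans (hS _ c0); apply: integral_ge0 => w _; rewrite lee_fin exprn_ge0.
  exists (fine S); first exact: fine_ge0.
  by move=> z cz; rewrite fineK ?ge0_fin_numE//; exact: hS.
have EJ : (\int[P]_w J w < +oo)%E.
  rewrite -(tonelli_leb2 P mG G0).
  pose c : R := (2 * 2) ^+ 7 + (2 * 8) ^+ 7 * M.
  have c0 : 0 <= c by rewrite addr_ge0 ?mulr_ge0 ?exprn_ge0.
  apply: (@le_lt_trans _ _ (\int[leb2 R]_z (c%:E * (\1_(cylinder T) z)%:E))%E).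
    apply: ge0_le_integral => //.
    - by move=> z _; exact: integral_ge0.
    - exact: (measurable_fun_fubini_tonelli_F (m2 := P) G mG G0).
    - apply: measurable_funeM; apply: measurable_EFinTS; apply: measurable_indic.
      exact: measurable_cylinder.
    move=> z _; rewrite indicE; have [|zT] := boolP (z \in cylinder T); last first.
      rewrite integral0_eq ?mule0// => w _.
      by rewrite /G/= /force indicE (negbTE zT) mul0r expr0n.
    rewrite inE mule1 => cz.
    have mu1 : measurable_fun setT (fun w => u z.1 z.2 w).
      exact: measurable_slice_u.
    apply: (@le_trans _ _ (\int[P]_w (((2 * 2) ^+ 7)%:E +
        ((2 * 8) ^+ 7)%:E * (`|u z.1 z.2 w| ^+ 42)%:E))%E).
      apply: ge0_le_integral => //.
      - by apply: measurable_EFinTS; apply: measurable_funX;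
          exact: (measurableT_comp measurable_force).
      - apply: emeasurable_funD; first exact: measurable_cst.
        apply: measurable_funeM; apply: measurable_EFinTS; apply: measurable_funX.
        exact: measurableT_comp.
      move=> w _; rewrite /G/= -EFinM -EFinD lee_fin /force indicE mem_set// mul1r.
      exact: reaction_pow14.
    have mu42 : measurable_fun setT (fun w => (`|u z.1 z.2 w| ^+ 42)%:E).
      by apply: measurable_EFinTS; apply: measurable_funX; exact: measurableT_comp.
    have u42 w : (0 <= (`|u z.1 z.2 w| ^+ 42)%:E)%E by rewrite lee_fin exprn_ge0.
    have k2 : 0 <= (2 * 8) ^+ 7 :> R by rewrite exprn_ge0// mulr_ge0.
    rewrite ge0_integralD; [|exact: measurableT
      |by move=> w _; rewrite lee_fin exprn_ge0// mulr_ge0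
      |exact: measurable_cst|by move=> w _; rewrite mule_ge0|exact: measurable_funeM].
    have -> : (\int[P]__ ((2 * 2) ^+ 7)%:E = ((2 * 2) ^+ 7)%:E)%E.
      by rewrite integral_cst//= probability_setT mule1.
    rewrite ge0_integralZl_EFin//.
    apply: (@le_trans _ _ (((2 * 2) ^+ 7)%:E + ((2 * 8) ^+ 7)%:E * M%:E)%E).
      by apply: leeD => //; apply: lee_wpmul2l => //; exact: hM.
    by rewrite -EFinM -EFinD.
  rewrite ge0_integralZl_EFin; [|exact: measurableT|by move=> z _; rewrite lee_fin
    |by apply: measurable_EFinTS; apply: measurable_indic; exact: measurable_cylinder
    |exact: c0].
  rewrite integral_indic ?setIT; [|exact: measurableT|exact: measurable_cylinder].
  by rewrite lte_mul_pinfty// cylinder_finite.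
have Ji : P.-integrable setT J.
  apply/integrableP; split => //.
  by rewrite (eq_integral J)// => w _; exact: gee0_abs.
have := integrable_ae measurableT Ji; apply: filterS => w /(_ I).
rewrite ge0_fin_numE// => Jw; apply: le_lt_trans Jw.
apply: ge0_subset_integral => //; first exact: measurable_cylinder.
by apply: measurable_EFinTS; apply: measurable_funX; exact: measurable_force_slice.
Qed.

Lemma hker0 x z : cylinder T z -> hker 0 x z = 0.
Proof.
case: z => r y [/=]; rewrite in_itv/= => /andP[r0 _] _.
exact: hker_out.
Qed.

Section pathwise.
Variables (x : R) (w : Omega) (J : R).
Hypothesis hJ : (\int[leb2 R]_(z in cylinder T) (force w z ^+ 14)%:E <= J%:E)%E.

Let C1 := 2 * T `^ (1 - 7 / 8) / (1 - 7 / 8).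
Let C2 := hker_L2_const T 4^-1 * T `^ 4^-1.

Let mcyl := measurable_cylinder T.

Lemma kernel_force_increment s t A : 0 <= s -> s <= t -> t <= T -> 0 < A ->
  (\int[leb2 R]_(z in cylinder T) `|(hker t x z - hker s x z) * force w z|%:E <=
   (A * (C1 * (t - s) `^ (7 / 8)) + A ^- 6 * (C2 + J))%:E)%E.
Proof.
move=> s0 st tT A0.
have T0' := ltW T0.
have A6 : 0 <= A ^- 6 by rewrite invr_ge0 exprn_ge0// ltW.
have A6' : (0 <= (A ^- 6)%:E)%E by rewrite lee_fin.
pose k z := hker t x z - hker s x z.
have mk : measurable_fun setT k by apply: measurable_funB; exact: measurable_hker.
have mf := measurable_force_slice w.
have m1 : measurable_fun setT (fun z => `|k z|%:E).
  by apply: measurable_EFinTS; exact: measurableT_comp.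
have m2 : measurable_fun setT (fun z => (k z ^+ 2)%:E).
  by apply: measurable_EFinTS; exact: measurable_funX.
have m3 : measurable_fun setT (fun z => (force w z ^+ 14)%:E).
  by apply: measurable_EFinTS; exact: measurable_funX.
have ev (r : R) : (0 <= (r ^+ 14)%:E)%E by rewrite lee_fin expr14_ge0.
have ev2 (r : R) : (0 <= (r ^+ 2)%:E)%E by rewrite lee_fin sqr_ge0.
have ev1 (r : R) : (0 <= `|r|%:E)%E by rewrite lee_fin.
apply: (@le_trans _ _ (\int[leb2 R]_(z in cylinder T)
   (A%:E * `|k z|%:E + (A ^- 6)%:E * ((k z ^+ 2)%:E + (force w z ^+ 14)%:E)))%E).
  apply: ge0_le_integral => //.
  - by apply: measurable_EFinTS; apply: measurableT_comp => //; exact: measurable_funM.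
  - apply: measurable_funTS; apply: emeasurable_funD; first exact: measurable_funeM.
    by apply: measurable_funeM; exact: emeasurable_funD.
  move=> z _.
  rewrite -[leRHS]/((A * `|k z| + A ^- 6 * (k z ^+ 2 + force w z ^+ 14))%:E) lee_fin.
  exact: normrM_young.
rewrite ge0_integralD; [|exact: mcyl|by move=> z _; rewrite mule_ge0 ?lee_fin ?(ltW A0)
  |by apply: measurable_funTS; exact: measurable_funeM
  |by move=> z _; apply: mule_ge0 => //; apply: adde_ge0
  |by apply: measurable_funTS; apply: measurable_funeM; exact: emeasurable_funD].
rewrite ge0_integralZl_EFin; [|exact: mcyl|by []|exact: measurable_funTS|exact: ltW].
rewrite ge0_integralZl_EFin; [|exact: mcyl|by move=> z _; rewrite adde_ge0
  |by apply: measurable_funTS; exact: emeasurable_funD|by []].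
rewrite ge0_integralD; [|exact: mcyl|by []|exact: measurable_funTS|by []
  |exact: measurable_funTS].
rewrite -[leRHS]/(A%:E * (C1 * (t - s) `^ (7 / 8))%:E + (A ^- 6)%:E * (C2%:E + J%:E))%E.
apply: leeD.
  by apply: lee_wpmul2l; [rewrite lee_fin ltW|apply: hker_L1_increment => //; lra].
apply: lee_wpmul2l; first by rewrite lee_fin.
apply: leeD => //.
have th4 : 0 < 4^-1 :> R by rewrite invr_gt0.
have th2 : 4^-1 < 2^-1 :> R by lra.
apply: (le_trans (hker_L2_increment x s0 st tT th4 th2)).
rewrite lee_fin /C2 /hker_L2_const.
rewrite ler_wpM2l ?divr_ge0 ?mulr_ge0 ?heat_bound_ge0 ?powR_ge0//; first by lra.
apply: ge0_ler_powR; rewrite ?nnegrE ?subr_ge0 ?invr_ge0//.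
by rewrite lerBlDr ler_wpDr.
Qed.

(** The increment estimate between times 0 and t, since the kernel at time 0
    vanishes on the cylinder. *)
Lemma integrable_kernel_force t : 0 <= t -> t <= T ->
  (leb2 R).-integrable (cylinder T) (fun z => (hker t x z * force w z)%:E).
Proof.
move=> t0 tT; apply/integrableP; split.
  by apply: measurable_EFinTS; apply: measurable_funM;
    [exact: measurable_hker|exact: measurable_force_slice].
have := kernel_force_increment (lexx 0) t0 tT ltr01.
move=> /le_lt_trans /(_ (ltry _)); congr (_ < _)%E.
by apply: eq_integral => z; rewrite inE => cz; rewrite hker0// subr0.
Qed.

Lemma integrable_increment s t : 0 <= s -> s <= t -> t <= T ->
  (leb2 R).-integrable (cylinder T)
    (EFin \o (fun z => (hker t x z - hker s x z) * force w z)).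
Proof.
move=> s0 st tT; apply/integrableP; split.
  apply: measurable_EFinTS; apply: measurable_funM; last exact: measurable_force_slice.
  by apply: measurable_funB; exact: measurable_hker.
have := kernel_force_increment s0 st tT ltr01.
by move=> /le_lt_trans /(_ (ltry _)).
Qed.

(** [kernel_force_increment] with A = (t - s)^(-1/8), for which
    A (t - s)^(7/8) = A^-6 = (t - s)^(3/4). *)
Lemma drift_increment s t : 0 <= s -> s < t -> t <= T ->
  `|drift u t x w - drift u s x w| <= (C1 + C2 + J) * (t - s) `^ (3 / 4).
Proof.
move=> s0 st tT; have sT : s <= T by rewrite (le_trans (ltW st)).
have t0 : 0 <= t by rewrite (le_trans s0)// ltW.
have h0 : 0 < t - s by rewrite subr_gt0.
have it := integrable_kernel_force t0 tT.
have is_ := integrable_kernel_force s0 sT.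
rewrite !drift_force// -RintegralB//.
have -> : \int[leb2 R]_(z in cylinder T) (hker t x z * force w z - hker s x z * force w z) =
    \int[leb2 R]_(z in cylinder T) ((hker t x z - hker s x z) * force w z).
  by apply: eq_Rintegral => z _; rewrite mulrBl.
have ih := integrable_increment s0 (ltW st) tT.
set A := (t - s) `^ (- 8^-1).
have A0 : 0 < A by exact: powR_gt0.
have -> : (C1 + C2 + J) * (t - s) `^ (3 / 4) =
  A * (C1 * (t - s) `^ (7 / 8)) + A ^- 6 * (C2 + J).
  have e1 : A * (t - s) `^ (7 / 8) = (t - s) `^ (3 / 4).
    rewrite /A -powRD; last by apply/implyP; rewrite (gt_eqF h0).
    by congr (_ `^ _); field.
  have e2 : A ^- 6 = (t - s) `^ (3 / 4).
    rewrite -(powR_mulrn 6 (ltW A0)) /A -powRrM -powRN; congr (_ `^ _).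
    by field.
  by rewrite e2 mulrCA e1; ring.
apply: normr_Rintegral_le; [exact: mcyl|exact: ih|].
exact: kernel_force_increment s0 (ltW st) tT A0.
Qed.

End pathwise.

(** The drift is defined outcome by outcome; its measurability comes from Tonelli
    applied to the positive and the negative part of the integrand. *)
Lemma measurable_drift t x : t <= T -> measurable_fun setT (drift u t x).
Proof.
move=> tT; pose kf (p : (R * R) * Omega) := (hker t x p.1 * force p.2 p.1)%:E.
have mkf : measurable_fun setT kf.
  apply: measurable_EFinTS; apply: measurable_funM; last exact: measurable_force.
  exact: (measurableT_comp (measurable_hker t x)).
have -> : drift u t x = fun w => fine (\int[leb2 R]_z (kf^\+ (z, w)) -
    \int[leb2 R]_z (kf^\- (z, w)))%E.
  apply/funext => w; rewrite drift_force// /Rintegral; congr fine.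
  have -> : (\int[leb2 R]_(z in cylinder T) (hker t x z * force w z)%:E =
      \int[leb2 R]_z kf (z, w))%E.
    rewrite integral_mkcond; apply: eq_integral => z _; rewrite /patch.
    by case: ifPn => // zT; rewrite /kf/= /force indicE (negbTE zT) mul0r mulr0.
  rewrite (integralE (leb2 R) setT (fun z => kf (z, w))); congr (_ - _)%E.
    by apply: eq_integral => z _; rewrite !funeposE.
  by apply: eq_integral => z _; rewrite !funenegE.
apply: measurableT_comp; first exact: fine_measurable.
apply: emeasurable_funB.
- apply: measurable_integral_leb2 => //; exact: measurable_funepos.
- apply: measurable_integral_leb2 => //; exact: measurable_funeneg.
Qed.

(** The process Y is the drift itself on [0, T]; it is truncated to 0 after T
    because u is measurable only up to that time. *)
Lemma drift_hoelder_modification x :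
  exists2 Y : R -> {RV P >-> R},
    (forall t w, t \in `[0, T] -> Y t w = drift u t x w) &
    {ae P, forall w, hoelder_on `[0, T] (3 / 4) (fun t => Y t w)}.
Proof.
pose Z t : Omega -> R := if t <= T then drift u t x else cst 0.
have mZ t : measurable_fun setT (Z t).
  by rewrite /Z; case: ifPn => // tT; exact: measurable_drift.
pose Y t : {RV P >-> R} := mfun_Sub (mem_set (mZ t)).
exists Y; first by move=> t w; rewrite in_itv/= /Z => /andP[_ ->].
have := force_moment_ae; apply: filterS => w Joo.
set I := (\int[leb2 R]_(z in _) _)%E in Joo.
have I0 : (0 <= I)%E.
  by apply: integral_ge0 => z _; rewrite lee_fin expr14_ge0.
have hJ : (I <= (fine I)%:E)%E by rewrite fineK// ge0_fin_numE.
eexists => s t; rewrite /= !in_itv/= => /andP[s0 sT] /andP[t0 tT].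
rewrite /Z sT tT; have [st|ts|->] := ltgtP s t.
- rewrite (gtr0_norm (_ : 0 < t - s)) ?subr_gt0//.
  exact: (drift_increment x hJ s0 st tT).
- rewrite distrC (ltr0_norm (_ : t - s < 0)) ?subr_lt0// opprB.
  exact: (drift_increment x hJ t0 ts sT).
- rewrite !subrr !normr0 mulr_ge0 ?powR_ge0//.
  have := drift_increment x hJ (lexx 0) T0 (lexx T).
  move=> /(le_trans (normr_ge0 _)); rewrite pmulr_lge0//.
  by rewrite powR_gt0 ?subr_gt0.
Qed.

End drift.

(** * The stochastic convolution and the solution *)

Section stochastic_convolution.
Context (R : realType) (d : measure_display) (Omega : measurableType d)
        (P : probability Omega R) (T : R).
Hypothesis T0 : 0 < T.
Variables (W : set (R * R) -> {RV P >-> R}) (X : R -> R -> {RV P >-> R}).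
Hypotheses (hW : white_noise T W) (hX : is_stochastic_convolution T W X).

Lemma convolution_increment_tail x th m s t lam : torus x -> 0 < th -> th < 2^-1 ->
  (0 < m)%N -> 0 <= s -> s < t -> t <= T -> 0 < lam ->
  (P [set w | (lam <= `|X t x w - X s x w|)%R] <=
   (increment_const R m * hker_L2_const T th ^+ m *
     (t - s) `^ (th *+ m) * lam `^ (- (m.*2)%:R))%:E)%E.
Proof.
move=> tx th0 th1 m0 s0 st tT lam0; set c := hker_L2_const T th.
have h0 : 0 < t - s by rewrite subr_gt0.
have t0 : 0 <= t by rewrite (le_trans s0)// ltW.
have sT : s <= T by rewrite (le_trans (ltW st)).
have c0 : 0 < c.
  rewrite /c /hker_L2_const divr_gt0 ?subr_gt0// mulr_gt0 ?powR_gt0// mulr_gt0//.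
  by rewrite mulr_gt0 ?expR_gt0// sqrtr_gt0 mulr_gt0.
have V0 : 0 < c * (t - s) `^ th by rewrite mulr_gt0// powR_gt0.
have It := hX (t := t) (x := x); rewrite in_itv/= t0 tT in It.
have Is := hX (t := s) (x := x); rewrite in_itv/= s0 sT in Is.
have var : (\int[leb2 R]_z ((\1_(cylinder t) z * hker t x z -
    \1_(cylinder s) z * hker s x z) ^+ 2)%:E <= (c * (t - s) `^ th)%:E)%E.
  under eq_integral do rewrite (cylinder_hker _ _ tT) (cylinder_hker _ _ sT) -mulrBr.
  rewrite (integral_indic_sqr (leb2 R)).
  have h := hker_L2_increment x s0 (ltW st) tT th0 th1.
  exact: (le_trans h).
have := wiener_increment_tail hW (@measurable_cylinder R t) (cylinder_subset tT)
  (@measurable_cylinder R s) (cylinder_subset sT) (measurable_hker t x)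
  (measurable_hker s x)
  (It isT tx) (Is isT tx) var V0 lam0 m0.
move=> /le_trans; apply; rewrite lee_fin.
have -> : lam `^ (- (m.*2)%:R) = (lam ^- 2) ^+ m.
  by rewrite powRN powR_mulrn ?(ltW lam0)// exprVn -exprM mul2n.
have -> : (t - s) `^ (th *+ m) = ((t - s) `^ th) ^+ m.
  by rewrite -mulr_natr powRrM powR_mulrn// powR_ge0.
set h := (t - s) `^ th.
rewrite le_eqVlt; apply/orP; left; apply/eqP.
by rewrite !exprMn; ring.
Qed.

(** Given gam < 1/4, the variance exponent th = gam + 1/4 lies strictly between
    2 gam and 1/2, so that th m - 2 m gam = (1/4 - gam) m exceeds 1 for m
    large, which is the condition of Kolmogorov's criterion with a = 2 m and
    b = th m. *)
Lemma convolution_hoelder_modification x : torus x ->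
  has_hoelder_modification P T 4^-1 (fun t w => X t x w).
Proof.
move=> tx; apply: (kolmogorov_continuity (Z := fun t => X t x)) => // gam gam0 gam4.
pose th := gam + 4^-1.
have th0 : 0 < th by rewrite /th; lra.
have th1 : th < 2^-1 by rewrite /th; lra.
have [m m0 hm] : exists2 m, (0 < m)%N & 1 < (4^-1 - gam) * m%:R.
  exists (Num.truncn (4^-1 - gam)^-1).+1 => //.
  rewrite mulrC -ltr_pdivrMr ?subr_gt0// mul1r.
  exact: real_truncnS_gt (num_real _).
have c0 : 0 <= hker_L2_const T th.
  by rewrite /hker_L2_const divr_ge0 ?subr_ge0 ?(ltW th1)// !mulr_ge0
    ?powR_ge0 ?heat_bound_ge0.
exists (increment_const R m * hker_L2_const T th ^+ m), (m.*2)%:R, (th *+ m); split.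
- by rewrite mulr_ge0 ?exprn_ge0 ?increment_const_ge0.
- by rewrite pmulrn_lgt0.
- rewrite -mul2n natrM -mulr_natr /th; lra.
move=> s t lam s0 sT t0 tT lam0; have [st|ts|->] := ltgtP s t.
- rewrite (gtr0_norm (_ : 0 < t - s)) ?subr_gt0//.
  exact: convolution_increment_tail.
- rewrite distrC (gtr0_norm (_ : 0 < s - t)) ?subr_gt0//.
  under eq_set do rewrite distrC.
  exact: convolution_increment_tail.
- rewrite (_ : [set w | _] = set0) ?measure0.
    by rewrite lee_fin !mulr_ge0 ?powR_ge0 ?exprn_ge0 ?increment_const_ge0.
  by apply/seteqP; split => w //=; rewrite subrr normr0 leNgt lam0.
Qed.

End stochastic_convolution.

Theorem corollary3p6 (R : realType) (d : measure_display)
    (Omega : measurableType d) (P : probability Omega R)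
    (T : R) (hT : 0 < T)
    (W : set (R * R) -> {RV P >-> R}) (hW : white_noise T W)
    (X : R -> R -> {RV P >-> R}) (hX : is_stochastic_convolution T W X)
    (u : R -> R -> Omega -> R) (hu : mild_solution T X u)
    (hmom : bounded_moments P T u)
    (beta : R) (hbeta : 4 / 3 < beta < 2) :
  (forall x : R, torus x ->
     has_hoelder_modification P T beta^-1 (fun t => drift u t x)) /\
  (forall x : R, torus x ->
     has_hoelder_modification P T 4^-1 (fun t => u t x)).
Proof.
have [mu_ hu2] := hu.
have [b1 b2] : beta^-1 <= 3 / 4 /\ 0 < beta.
  move: hbeta => /andP[b1 _]; have b0 : 0 < beta by apply: lt_trans b1; rewrite divr_gt0.
  by split => //; rewrite -[leRHS]invf_div lef_pV2 ?posrE ?divr_gt0// ltW.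
split=> x tx.
  have [Y YE hY] := drift_hoelder_modification hT mu_ hmom x.
  exists Y; split; first by move=> t tT; apply: aeW => w; exact: YE.
  apply: filterS hY => w hw del /andP[del0 delb].
  apply: (hoelder_on_le (ltW hT) del0 _ hw).
  by rewrite (le_trans (ltW delb)).
have [Y YE hY] := drift_hoelder_modification hT mu_ hmom x.
have [Xt [XE hXt]] := convolution_hoelder_modification hT hW hX tx.
exists (fun t => (Xt t \+ Y t : {mfun _ >-> _})); split.
  move=> t tT; have := XE t tT; have := hu2 t x tT tx.
  apply: filterS2 => w [_ ->] XEw /=.
  by rewrite XEw YE.
move: hXt hY; apply: filterS2 => w hXw hYw del hdel.
apply: hoelder_onD; first exact: hXw.
move: hdel => /andP[del0 del4].
apply: (hoelder_on_le (ltW hT) del0 _ hYw).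
by rewrite (le_trans (ltW del4))//; lra.
Qed.
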